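(* Let $a>0$, $T>0$, $B_a=\{\mathbf x\in\mathbb R^3:\|\mathbf x\|<a\}$, and let $c:\mathbb R^3\to(0,\infty)$ be smooth and equal to a constant $c_0>0$ outside $B_a$. Let $\mathbf A:L^2(B_a)\to L^2(\mathbb R^3)$ be the bounded linear operator mapping an initial pressure $f$ to the solution at time $T$ of the wave equation with sound speed $c$ and initial data $(f,0)$, and let $\mathbf A^*:L^2(\mathbb R^3)\to L^2(B_a)$ be the adjoint operator of $\mathbf A$. Let $g\in C_0^\infty(\mathbb R^3)$ and consider the time-reversed final state problem for the wave equation, with solution $q$, $$q_{tt}(\mathbf x,t)-c(\mathbf x)^2\Delta q(\mathbf x,t)=0 \ \text{ for } (\mathbf x,t)\in\mathbb R^3\times(-\infty,T),\qquad q(\mathbf x,T)=g(\mathbf x),\quad q_t(\mathbf x,T)=0\ \text{ for }\mathbf x\in\mathbb R^3 .$$ Let $\chi_{B_a}$ denote the indicator function of $B_a$. Then $$\mathbf A^* g=\chi_{B_a}\, q(\cdot,0).$$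
   Context: For $f\in C_0^\infty(B_a)$ (extended by zero to $\mathbb R^3$), let $p$ be the solution of $$p_{tt}(\mathbf x,t)-c^2(\mathbf x)\Delta p(\mathbf x,t)=0 \ \text{ for } (\mathbf x,t)\in \mathbb R^3\times(0,\infty),\qquad p(\mathbf x,0)=f(\mathbf x),\quad p_t(\mathbf x,0)=0 \ \text{ for } \mathbf x\in\mathbb R^3,$$ and set $\mathbf A f=p(\cdot,T)$, where $T>0$ is the fixed measurement time. This operator extends to a bounded linear operator $\mathbf A:L^2(B_a)\to L^2(\mathbb R^3)$, and $\mathbf A^*: L^2(\mathbb R^3)\to L^2(B_a)$ denotes its adjoint.
   Formalization: The adjoint A^* is taken for the inner products weighted by c^{-2} on L^2(B_a) and L^2(R^3); with the unweighted L^2 inner product the identity fails for non-constant c, and for constant c the two adjoints coincide. *)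

(* Defs.v *)
From HB Require Import structures.
From mathcomp Require Import all_boot all_order all_algebra.
From mathcomp Require Import all_classical all_reals all_analysis measurable_realfun.

Set Implicit Arguments.
Unset Strict Implicit.
Unset Printing Implicit Defensive.

Import Order.TTheory GRing.Theory Num.Theory.
Import numFieldNormedType.Exports.

Local Open Scope classical_set_scope.
Local Open Scope ring_scope.

Section Smoothness.
Context {R : realType} {V : normedModType R}.

Definition iter_derive (s : seq V) (u : V -> R) : V -> R :=
  foldr (fun v w => 'D_v w) u s.

(* C^k up to the boundary of an open set D, the space usually written
   C^k(closure D): every iterated directional derivative of order at most k
   exists in D and has a limit, taken from within D, at every point of the
   closure of D. At a point of D that limit is the value, so this contains the
   continuity of the derivatives in D. Only the values of u in D matter. *)
Definition Ck_closure (k : nat) (D : set V) (u : V -> R) : Prop :=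
  forall s : seq V, (size s <= k)%N ->
    (forall x v, D x -> (size s < k)%N -> derivable (iter_derive s u) x v) /\
    (forall x, closure D x ->
       exists l : R, iter_derive s u @ within D (nbhs x) --> l).

Definition smooth (u : V -> R) : Prop := forall k, Ck_closure k setT u.

(* The functions of C_0^oo(U), extended by zero. *)
Definition Cc_infty (U : set V) (u : V -> R) : Prop :=
  [/\ smooth u, compact (closure [set x | u x != 0]) &
      closure [set x | u x != 0] `<=` U].

End Smoothness.

(* R3 carries the product topology, and M3 is the same type with its Borel
   sigma-algebra. The library norm on a product is the maximum norm, hence the
   separate Euclidean norm. *)
Definition R3 (R : realType) : Type := (R * R * R)%type.
Definition M3 (R : realType) : Type :=
  (measurableTypeR R * measurableTypeR R * measurableTypeR R)%type.

Section Space.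
Context {R : realType}.

Definition norm3 (x : R3 R) : R :=
  Num.sqrt (x.1.1 ^+ 2 + x.1.2 ^+ 2 + x.2 ^+ 2).

Definition ball3 (a : R) : set (R3 R) := [set x | norm3 x < a].

Definition leb3 : {measure set (M3 R) -> \bar R} :=
  (@lebesgue_measure R \x @lebesgue_measure R \x @lebesgue_measure R)%E.

Lemma measurable_ball3 (a : R) : measurable (ball3 a : set (M3 R)).
Proof.
have m : measurable_fun setT (norm3 : M3 R -> measurableTypeR R).
  apply: (@measurableT_comp _ _ _ _ _ _ (@Num.sqrt R)).
    exact: (continuous_measurable_fun (@sqrt_continuous R)).
  apply: measurable_funD; first apply: measurable_funD; apply: measurable_funX.
  - exact: (measurableT_comp measurable_fst measurable_fst).
  - exact: (measurableT_comp measurable_snd measurable_fst).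
  - exact: measurable_snd.
have := m measurableT [set` `]-oo, a[] (measurable_itv _).
by rewrite setTI set_itvNyo.
Qed.

(* Lebesgue measure on ball3 a, extended by zero to the whole space. *)
Definition leb_ball (a : R) : {measure set (M3 R) -> \bar R} :=
  mrestr leb3 (measurable_ball3 a).

Implicit Types (c f : R3 R -> R) (p : R3 R * R -> R).

Definition e_t : R3 R * R := ((0, 0, 0), 1).
Definition e_x1 : R3 R * R := ((1, 0, 0), 0).
Definition e_x2 : R3 R * R := ((0, 1, 0), 0).
Definition e_x3 : R3 R * R := ((0, 0, 1), 0).

Definition laplacian p (z : R3 R * R) : R :=
  'D_e_x1 ('D_e_x1 p) z + 'D_e_x2 ('D_e_x2 p) z + 'D_e_x3 ('D_e_x3 p) z.

(* Classical solutions, of class C^2 up to the boundary, of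
   u_tt - c^2 Delta u = 0 in the open half space-time D bounded by {t = t0},
   with u(x, t0) = f(x) and u_t(x, t0) = 0 as limits from within D. *)
Definition wave_solution c (D : set (R3 R * R)) (t0 : R) f p : Prop :=
  [/\ Ck_closure 2 D p,
      forall x t, D (x, t) ->
        'D_e_t ('D_e_t p) (x, t) - c x ^+ 2 * laplacian p (x, t) = 0,
      forall x : R3 R, p @ within D (nbhs (x, t0)) --> f x &
      forall x : R3 R, 'D_e_t p @ within D (nbhs (x, t0)) --> (0 : R)].

Definition initial_solution c f p : Prop :=
  wave_solution c [set z | 0 < z.2] 0 f p.

Definition final_solution c (T : R) f p : Prop :=
  wave_solution c [set z | z.2 < T] T f p.

End Space.

(* An element of L^2 is given by a square-integrable representative, so
   equalities in L^2 are equalities almost everywhere. *)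
Notation L2 mu := (LfunType mu (lee1n 2)).

(* An operator on L^2 acts on representatives; linearity holds almost
   everywhere and the bound makes the operator compatible with almost
   everywhere equality. *)
Definition bounded_linear {R : realType} {d d'} {X : measurableType d}
    {Y : measurableType d'} {mu : {measure set X -> \bar R}}
    {nu : {measure set Y -> \bar R}} (A : L2 mu -> L2 nu) : Prop :=
  (forall (k : R) (f h : L2 mu),
     A (k *: f + h) = (fun y => k * A f y + A h y) %[ae nu]) /\
  (exists M : R, forall f : L2 mu,
     ('N[nu]_2[EFin \o A f] <= M%:E * 'N[mu]_2[EFin \o f])%E).

Section Operators.
Context {R : realType}.

Definition maps_initial_pressure (a T : R) (c : R3 R -> R)
    (A : L2 (leb_ball a) -> L2 leb3) : Prop :=
  forall f : R3 R -> R, Cc_infty (ball3 a) f ->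
    exists2 p : R3 R * R -> R, initial_solution c f p &
      forall F : L2 (leb_ball a), F = f %[ae leb_ball a] ->
        A F = (fun x => p (x, T)) %[ae leb3].

(* The operator c^2 Delta is symmetric for the measure c^-2 dx, and not for dx
   unless c is constant: the adjoint is taken for the inner product with weight
   c^-2. As c is continuous, positive and constant outside a ball, the weighted
   norm is equivalent to the norm of L2. *)
Definition is_adjoint (a : R) (c : R3 R -> R)
    (A : L2 (leb_ball a) -> L2 leb3) (As : L2 leb3 -> L2 (leb_ball a)) : Prop :=
  forall (f : L2 (leb_ball a)) (h : L2 leb3),
    \int[leb3]_x (A f x * h x / c x ^+ 2) =
    \int[leb_ball a]_x (f x * As h x / c x ^+ 2).

End Operators.

(* Main.v *)
From HB Require Import structures.
Require Import Defs.
From mathcomp Require Import all_boot all_order all_algebra.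
From mathcomp Require Import all_classical all_reals all_analysis.
From mathcomp Require Import measurable_realfun ring lra.
Import Order.TTheory GRing.Theory Num.Theory.
Import numFieldNormedType.Exports.
Local Open Scope classical_set_scope.
Local Open Scope ring_scope.
Set Implicit Arguments.
Unset Strict Implicit.
Unset Printing Implicit Defensive.

(** The operator c^2 Delta is symmetric for the weight c^-2, and the theorem says
that the solution operator of the wave equation at time T is then symmetric too,
solving backwards from T being the same as solving forwards.

Let p solve the equation with data (f, 0), where f is smooth with compact support
in the ball, and let r(x, t) = q(x, T - t), which solves it with data (g, 0). The
Wronskian
  int c^-2 (p_t(t) r(s - t) + p(t) r_t(s - t)) dx
does not depend on t in [0, s], because its derivative is the integral of
Delta p r - p Delta r, a divergence. Its values at t = 0 and t = s are
int c^-2 f r_t(s) and int c^-2 p_t(s) g (wronskian_conserved), so the functions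
int c^-2 f r(s) and int c^-2 p(s) g of s have the same derivative. They agree at
s = 0, hence at s = T (wave_pairing), which is the pairing of A f with g and of f
with q(., 0). By the definition of the adjoint, A^* g - q(., 0) is therefore
orthogonal, for the weight c^-2, to all smooth f with compact support in the ball,
so it vanishes almost everywhere there (null_of_tests).

The integration by parts is legitimate because r has bounded support in x
(jet_support). This is finite speed of propagation: the energy of a solution,
weighted by the C^1 function (s^2 - K t - |x - x0|^2)_+^2, does not increase if
K = 2 M s where M bounds c; it is zero if the data vanish in the ball of radius s
about x0, and then the solution vanishes at x0 up to time s / (2 M)
(finite_propagation).

Solutions are C^2 up to the boundary of a half space-time only. Their derivatives
are replaced by continuous functions on the whole space-time (wave_jet), which
makes all integrands continuous up to the initial time. The second derivatives in
x and t commute by Schwarz's theorem (mixed_derivatives_eq).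

Orthogonality to test functions is exploited through explicit ones, built from
exp(-1/x), that converge to the indicator of the intersection of an octant with a
ball. Octants are stable under intersection and generate the Borel sets, so the
integral of the function over every Borel set is zero (integral_octants_eq0). *)

(** * Continuity and derivatives of real-valued expressions *)

Section Continuity.
Context {R : realType} {T : topologicalType}.

Lemma cont_cst {U : topologicalType} (k : U) : continuous (fun _ : T => k).
Proof. by move=> x; exact: cvg_cst. Qed.

Lemma cont_id : continuous (fun x : T => x).
Proof. by move=> x; exact: cvg_id. Qed.

Lemma cont_pair {U V : topologicalType} (f : T -> U) (g : T -> V) :
  continuous f -> continuous g -> continuous (fun x => (f x, g x)).
Proof. by move=> cf cg x; apply: cvg_pair; [exact: cf|exact: cg]. Qed.

Lemma cont_fst {U V : topologicalType} (f : T -> U * V) :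
  continuous f -> continuous (fun x => (f x).1).
Proof. by move=> cf x; apply: (cvg_comp _ _ (cf x)); exact: cvg_fst. Qed.

Lemma cont_snd {U V : topologicalType} (f : T -> U * V) :
  continuous f -> continuous (fun x => (f x).2).
Proof. by move=> cf x; apply: (cvg_comp _ _ (cf x)); exact: cvg_snd. Qed.

Lemma cont_comp {U V : topologicalType} (f : T -> U) (g : U -> V) :
  continuous g -> continuous f -> continuous (fun x => g (f x)).
Proof. by move=> cg cf x; apply: (cvg_comp _ _ (cf x)); exact: cg. Qed.

Implicit Types f g : T -> R.

Lemma cont_add f g : continuous f -> continuous g ->
  continuous (fun x => f x + g x).
Proof. by move=> cf cg x; apply: cvgD; [exact: cf|exact: cg]. Qed.

Lemma cont_opp f : continuous f -> continuous (fun x => - f x).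
Proof. by move=> cf x; apply: cvgN; exact: cf. Qed.

Lemma cont_mul f g : continuous f -> continuous g ->
  continuous (fun x => f x * g x).
Proof. by move=> cf cg x; apply: cvgM; [exact: cf|exact: cg]. Qed.

Lemma cont_exp f n : continuous f -> continuous (fun x => f x ^+ n).
Proof. by move=> cf x; exact: (continuous_comp (cf x) (@exprn_continuous _ n _)). Qed.

Lemma cont_max f g : continuous f -> continuous g ->
  continuous (fun x => Num.max (f x) (g x)).
Proof. by move=> cf cg x; exact: (continuous_max (cf x) (cg x)). Qed.

Lemma cont_inv f : (forall x, f x != 0) -> continuous f ->
  continuous (fun x => (f x)^-1).
Proof. by move=> f0 cf x; apply: cvgV => //; exact: cf. Qed.

End Continuity.

(** Continuity by recursion on the syntax of the function: matching on the head
symbol keeps unification from unfolding the functions involved. *)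
Ltac cont := repeat (cbv beta; lazymatch goal with
  | |- continuous (fun _ => ?k) => exact: cont_cst
  | |- continuous (fun x => @?f x + @?g x) => apply: (@cont_add _ _ f g)
  | |- continuous (fun x => - (@?f x)) => apply: (@cont_opp _ _ f)
  | |- continuous (fun x => @?f x * @?g x) => apply: (@cont_mul _ _ f g)
  | |- continuous (fun x => @?f x ^+ ?n) => apply: (@cont_exp _ _ f n)
  | |- continuous (fun x => Num.max (@?f x) (@?g x)) => apply: (@cont_max _ _ f g)
  | |- continuous (fun x => (@?f x, @?g x)) => apply: (@cont_pair _ _ _ f g)
  | |- continuous (fun x => x) => exact: cont_id
  | |- continuous (fun x => (@?f x).1) => apply: (@cont_fst _ _ _ f)
  | |- continuous (fun x => (@?f x).2) => apply: (@cont_snd _ _ _ f)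
  | H : continuous ?g |- continuous ?g => exact: H
  | H : continuous ?g |- continuous (fun x => ?g (@?f x)) =>
      apply: (@cont_comp _ _ _ f g H)
  | H : forall i, continuous (@?g i) |- continuous (?h ?i) => exact: (H i)
  | H : forall i, continuous (?g i) |- continuous (fun x => ?g ?i (@?f x)) =>
      apply: (@cont_comp _ _ _ f (g i) (H i))
  end).

Section Derivation.
Context {R : realType} {V : normedModType R}.
Implicit Types (f g : V -> R) (x v : V).

Lemma der_cst x v (k : R) : is_derive x v (fun _ => k) 0.
Proof. exact: is_derive_cst. Qed.

Lemma der_add f g x v a b : is_derive x v f a -> is_derive x v g b ->
  is_derive x v (fun s => f s + g s) (a + b).
Proof. by move=> df dg; exact: is_deriveD. Qed.

Lemma der_opp f x v a : is_derive x v f a ->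
  is_derive x v (fun s => - f s) (- a).
Proof. by move=> df; exact: is_deriveN. Qed.

Lemma der_mul f g x v a b : is_derive x v f a -> is_derive x v g b ->
  is_derive x v (fun s => f s * g s) (a * g x + f x * b).
Proof.
move=> df dg; have H : is_derive x v (f * g) (f x *: b + g x *: a).
  exact: is_deriveM.
by apply: (is_derive_eq H); rewrite /GRing.scale /= addrC (mulrC a).
Qed.

Lemma der_exp2 f x v a : is_derive x v f a ->
  is_derive x v (fun s => f s ^+ 2) (2 * f x * a).
Proof.
by move=> df; apply: (is_derive_eq (der_mul df df)); ring.
Qed.

(** Directional derivatives are derivatives along lines, so the chain rule with
a scalar outer function needs no differentiability of the inner one. *)
Lemma der_line f x v a :
  is_derive x v f a <-> is_derive (0 : R) (1 : R) (fun h : R => f (h *: v + x)) a.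
Proof.
have E : (fun h : R => h^-1 *: (f (h *: v + x) - f x)) =
    (fun h : R => h^-1 *: (f ((h *: (1 : R) + 0) *: v + x) - f (0 *: v + x))).
  by apply/funext => h; rewrite addr0 scale0r add0r /GRing.scale /= mulr1.
split => -[d1 d2]; split.
- by move: d1; rewrite /derivable E.
- by rewrite -d2 /derive E.
- by move: d1; rewrite /derivable E.
- by rewrite -d2 /derive E.
Qed.

Lemma der_scalar_comp (h : R -> R) f x v a b : is_derive (f x) (1 : R) h a ->
  is_derive x v f b -> is_derive x v (fun s => h (f s)) (a * b).
Proof.
move=> dh /der_line df; apply/der_line.
apply: (@is_derive1_comp _ h (fun r : R => f (r *: v + x))) => //.
by rewrite scale0r add0r.
Qed.

End Derivation.

Section ScalarDerivation.
Context {R : realType}.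
Implicit Types f g : R -> R.

Lemma der_id (t : R) : is_derive t (1 : R) (fun x => x) 1.
Proof. exact: is_derive_id. Qed.

Lemma der_comp f g t a b : is_derive (g t) (1 : R) f a ->
  is_derive t (1 : R) g b -> is_derive t (1 : R) (fun s => f (g s)) (a * b).
Proof. by move=> df dg; exact: is_derive1_comp. Qed.

(** The square makes the positive part differentiable at the origin. *)
Lemma der_pos2 (t : R) :
  is_derive t (1 : R) (fun s => Num.max s 0 ^+ 2) (2 * Num.max t 0).
Proof.
have [t0|t0|->] := ltgtP t 0.
- rewrite mulr0; apply: (near_eq_is_derive (f := cst 0)).
  near=> s; rewrite max_r ?expr0n//; apply: ltW; near: s; exact: lt_nbhsl.
- apply: (near_eq_is_derive (f := fun s : R => s ^+ 2)); last first.
    by apply: (is_derive_eq (der_exp2 (der_id t))); rewrite mulr1.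
  near=> s; rewrite max_l//; apply: ltW; near: s; exact: lt_nbhsr.
- rewrite mulr0.
  have H : h^-1 *: (Num.max (h *: (1 : R) + 0) 0 ^+ 2 - Num.max 0 0 ^+ 2)
      @[h --> (0:R)^'] --> (0 : R).
    apply/cvgrPdist_le => e e0; near=> h.
    rewrite maxxx expr0n subr0 addr0 /GRing.scale /= mulr1 sub0r normrN normrM normfV.
    have h0 : h != 0 by near: h; exact: nbhs_dnbhs_neq.
    rewrite ler_pdivrMl ?normr_gt0// mulrC.
    have he : `|h| <= e.
      by near: h; apply: dnbhs0_le.
    rewrite ger0_norm ?sqr_ge0//.
    have [h1|h1] := lerP 0 h.
      rewrite ger0_norm// in he *.
      by rewrite expr2 ler_wpM2r.
    by rewrite expr0n mulr_ge0// ltW.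
  by split; [apply/cvg_ex; exists 0|apply: cvg_lim].
Unshelve. all: by end_near. Qed.

End ScalarDerivation.

(** * Integration of continuous functions over a box *)

Section BoxIntegral.
Context {R : realType}.
Notation R3 := (R3 R).
Notation M3 := (M3 R).

Definition cube (q : rat * rat * rat * (rat * rat * rat)) : set R3 :=
  [set x | [/\ ratr q.1.1.1 < x.1.1 < ratr q.2.1.1,
               ratr q.1.1.2 < x.1.2 < ratr q.2.1.2 &
               ratr q.1.2 < x.2 < ratr q.2.2]].

Lemma measurable_cube q : measurable (cube q : set M3).
Proof.
have -> : cube q = `]ratr q.1.1.1, ratr q.2.1.1[%classic `*`
  `]ratr q.1.1.2, ratr q.2.1.2[%classic `*` `]ratr q.1.2, ratr q.2.2[%classic.
  apply/seteqP; split => [[[x y] z] []/= h1 h2 h3|[[x y] z] [[]]] /=.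
    by split; [split|]; rewrite /= in_itv.
  by rewrite !in_itv.
apply: measurableX; first apply: measurableX.
all: exact: measurable_itv.
Qed.

Lemma ball_cube (x : R3) (e : R) : 0 < e -> exists q, cube q x /\ cube q `<=` ball x e.
Proof.
move=> e0; case: x => [[x y] z].
have H (s : R) : exists q : rat * rat, ratr q.1 < s < ratr q.2 /\
    forall s' : R, ratr q.1 < s' < ratr q.2 -> ball s e s'.
  have /rat_in_itvoo[q1] : s - e < s by lra.
  rewrite in_itv/= => /andP[? ?].
  have /rat_in_itvoo[q2] : s < s + e by lra.
  rewrite in_itv/= => /andP[? ?].
  exists (q1, q2) => /=; split; first lra.
  by move=> s' ?; rewrite /ball/= ltr_norml; lra.
have [[a1 b1] /= [? h1]] := H x.
have [[a2 b2] /= [? h2]] := H y.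
have [[a3 b3] /= [? h3]] := H z.
exists (a1, a2, a3, (b1, b2, b3)); split=> //.
by move=> [[x' y'] z'] [/= /h1 ? /h2 ? /h3 ?]; split => //; split.
Qed.

(** Rational cubes form a countable basis of the topology, and they are measurable
for the product sigma-algebra. *)
Lemma open_measurable3 (U : set R3) : open U -> measurable (U : set M3).
Proof.
move=> oU.
have -> : (U : set M3) = \bigcup_q (if `[< cube q `<=` U >] then cube q else set0).
  apply/seteqP; split => [x Ux|x [q _]]; last by case: asboolP => // h /h.
  have /nbhs_ballP[e /= e0 eU] : nbhs (x : R3) U by apply: open_nbhs_nbhs.
  have [q [qx qe]] := ball_cube x e0.
  exists q => //; case: asboolP => // -[]; exact: subset_trans eU.
apply: countable_bigcupT_measurable => // q.
by case: ifPn => // _; exact: measurable_cube.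
Qed.

Lemma continuous_measurable3 (F : R3 -> R) : continuous F ->
  measurable_fun setT (F : M3 -> R).
Proof.
move=> /continuousP cF; apply: (measurability _ (RGenOpens.measurableE R)).
move=> _ [_ [a [b ->] <-]]; rewrite setTI; apply: open_measurable3.
exact/cF/interval_open.
Qed.

Definition box (L : R) : set R3 := `[-L, L] `*` `[-L, L] `*` `[-L, L].

Lemma boxE L (x : R3) :
  box L x <-> [/\ `|x.1.1| <= L, `|x.1.2| <= L & `|x.2| <= L].
Proof.
by rewrite /box/= !in_itv/= -!ler_norml; split => [[[]]|[]].
Qed.

Lemma measurable_box L : measurable (box L : set M3).
Proof.
by apply: measurableX; [apply: measurableX|]; exact: measurable_itv.
Qed.

Lemma compact_box L : compact (box L).
Proof.
by apply: compact_setX; [apply: compact_setX|]; exact: segment_compact.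
Qed.

Lemma leb3_prod (A B C : set R) : measurable A -> measurable B -> measurable C ->
  leb3 (A `*` B `*` C : set M3) =
  (@lebesgue_measure R A * @lebesgue_measure R B * @lebesgue_measure R C)%E.
Proof.
move=> mA mB mC; rewrite -[(@lebesgue_measure R A * _)%E]product_measure1E//.
by apply: product_measure1E => //; exact: measurableX.
Qed.

Lemma leb3_box_lty L : (leb3 (box L : set M3) < +oo)%E.
Proof.
rewrite leb3_prod ?lebesgue_measure_itv//=; try exact: measurable_itv.
by case: ifPn => _; rewrite ?mul0e// -!EFinB -!EFinM ltry.
Qed.

Lemma continuous_integrable_box (F : R3 -> R) L : continuous F ->
  leb3.-integrable (box L) (EFin \o F).
Proof.
move=> cF; apply: measurable_bounded_integrable.
- exact: measurable_box.
- exact: leb3_box_lty.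
- by apply: measurable_funS (continuous_measurable3 cF).
- have /compact_bounded[M [Mr hM]] : compact (F @` box L).
    apply: continuous_compact; last exact: compact_box.
    exact: continuous_subspaceT.
  by exists M; split => // N MN x Bx; apply: hM => //; exists x.
Qed.

Definition boxint (L : R) (F : R3 -> R) : R := \int[leb3]_(x in box L) F x.

Lemma eq_boxint L (F G : R3 -> R) : (forall x, box L x -> F x = G x) ->
  boxint L F = boxint L G.
Proof. by move=> FG; apply: eq_Rintegral => x; rewrite inE; exact: FG. Qed.

Lemma boxintD L (F G : R3 -> R) : continuous F -> continuous G ->
  boxint L (fun x => F x + G x) = boxint L F + boxint L G.
Proof.
move=> cF cG; apply: RintegralD; first exact: measurable_box.
all: exact: continuous_integrable_box.
Qed.

Lemma boxintZ L (k : R) (F : R3 -> R) : continuous F ->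
  boxint L (fun x => k * F x) = k * boxint L F.
Proof.
move=> cF; apply: RintegralZl; first exact: measurable_box.
exact: continuous_integrable_box.
Qed.

Lemma boxint0 L : boxint L (fun _ => 0) = 0.
Proof. by rewrite /boxint Rintegral_cst ?mul0r//; exact: measurable_box. Qed.

Lemma boxint_ge0 L (F : R3 -> R) : (forall x, box L x -> 0 <= F x) ->
  0 <= boxint L F.
Proof. by move=> F0; exact: Rintegral_ge0. Qed.

End BoxIntegral.

Section BoxParam.
Context {R : realType}.
Notation R3 := (R3 R).
Notation M3 := (M3 R).

Lemma continuous_slice (F : R3 * R -> R) (t : R) : continuous F ->
  continuous (fun x : R3 => F (x, t)).
Proof.
by move=> cF; cont.
Qed.

Lemma continuous_time (F : R3 * R -> R) (x : R3) : continuous F ->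
  continuous (fun t : R => F (x, t)).
Proof.
by move=> cF; cont.
Qed.

Lemma bounded_box_time (F : R3 * R -> R) (L u v : R) : continuous F ->
  exists2 M, 0 <= M & forall x t, box L x -> u <= t <= v -> `|F (x, t)| <= M.
Proof.
move=> cF.
have /compact_bounded[M [Mr hM]] : compact (F @` (box L `*` `[u, v])).
  apply: continuous_compact; first exact: continuous_subspaceT.
  by apply: compact_setX; [exact: compact_box|exact: segment_compact].
exists (`|M| + 1); first by rewrite addr_ge0.
move=> x t Bx tuv; apply: (hM (`|M| + 1)).
  by rewrite (le_lt_trans (ler_norm M))// ltrDl.
by exists (x, t) => //; split => //=; rewrite in_itv.
Qed.

Lemma integrable_box_cst L (M : R) :
  (@leb3 R).-integrable (box L) (EFin \o cst M).
Proof. by apply: continuous_integrable_box; exact: cst_continuous. Qed.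

Lemma continuous_boxint L (F : R3 * R -> R) : continuous F ->
  continuous (fun t => boxint L (fun x => F (x, t))).
Proof.
move=> cF t.
have [M M0 hM] := bounded_box_time L (t - 1) (t + 1) cF.
apply: (@continuity_under_integral _ _ _ leb3 (fun t x => F (x, t)) _
  (measurable_box L) (t - 1) (t + 1) _ _ (cst M)).
- by move=> s _; apply: continuous_integrable_box; exact: continuous_slice.
- by apply: aeW => x _ s _; exact: continuous_time.
- exact: integrable_box_cst.
- move=> s; rewrite /= in_itv/= => /andP[s1 s2]; apply: aeW => x Bx.
  by apply: hM => //; rewrite !ltW.
- by rewrite inE/= in_itv/=; lra.
Qed.

(** The derivative is bounded on the compact set box L x [u, v], which gives the
constant dominating function. *)
Lemma is_derive_boxint L (F F' : R3 * R -> R) (u v a : R) :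
  continuous F -> continuous F' -> u < a < v ->
  (forall x t, box L x -> u < t < v ->
     is_derive t (1 : R) (fun s => F (x, s)) (F' (x, t))) ->
  is_derive a (1 : R) (fun t => boxint L (fun x => F (x, t)))
    (boxint L (fun x => F' (x, a))).
Proof.
move=> cF cF' uav dF.
have [M M0 hM] := bounded_box_time L u v cF'.
have Ia : a \in `]u, v[ by rewrite in_itv.
have If s : `]u, v[%classic s ->
    leb3.-integrable (box L) (EFin \o (fun x : M3 => F (x, s))).
  by move=> _; apply: continuous_integrable_box; exact: continuous_slice.
have D s x : `]u, v[%classic s -> box L x ->
    derivable (fun s => F (x, s)) s 1.
  by rewrite /= in_itv/= => suv Bx; have [] := dF x s Bx suv.
have E s x : u < s < v -> box L x ->
    partial1of2 (fun s x => F (x, s)) s x = F' (x, s).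
  move=> suv Bx; rewrite partial1of2E.
  by apply: derive_val; exact: dF.
have B s x : `]u, v[%classic s -> box L x ->
    `|partial1of2 (fun s x => F (x, s)) s x| <= M.
  rewrite /= in_itv/= => suv Bx; rewrite E//; apply: hM => //.
  by case/andP: suv => *; rewrite !ltW.
have G0 (y : M3) : 0 <= cst M y by [].
split.
  exact: (derivable_under_integral (measurable_box L) Ia If D G0
    (integrable_box_cst L M) B).
rewrite -derive1E (differentiation_under_integral (measurable_box L) Ia If D G0
    (integrable_box_cst L M) B).
by apply: eq_Rintegral => x; rewrite inE => Bx; exact: E.
Qed.

(** If F is positive at an interior point of the box, it is at least half its value
on a small cube, which has positive measure. *)
Lemma boxint_eq0_pt L (F : R3 -> R) (x0 : R3) : continuous F ->
  (forall x, box L x -> 0 <= F x) ->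
  boxint L F = 0 ->
  `|x0.1.1| < L -> `|x0.1.2| < L -> `|x0.2| < L -> F x0 = 0.
Proof.
move=> cF F0 I0 h1 h2 h3.
apply/eqP; rewrite eq_le F0 ?andbT; last by apply/boxE; rewrite !ltW.
rewrite leNgt; apply/negP => Fx0.
have : \forall x \near x0, F x0 / 2 < F x by apply: (cvgr_gt (F x0) (cF x0)); lra.
case/nbhs_ballP => e /= e0 he.
pose d := Num.min (e / 2) (Num.min (L - `|x0.1.1|) (Num.min (L - `|x0.1.2|) (L - `|x0.2|))).
have d0 : 0 < d by rewrite /d !lt_min; lra.
have [de [d1 [d2 d3]]] : d <= e / 2 /\ d <= L - `|x0.1.1| /\ d <= L - `|x0.1.2| /\ d <= L - `|x0.2|.
  by rewrite /d !ge_min !lexx !orbT.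
pose Q : set R3 := `[x0.1.1, x0.1.1 + d] `*` `[x0.1.2, x0.1.2 + d] `*` `[x0.2, x0.2 + d].
have mQ : measurable (Q : set M3).
  by apply: measurableX; [apply: measurableX|]; exact: measurable_itv.
have QL : Q `<=` box L.
  move=> x [[]]; rewrite /= !in_itv/= => q1 q2 q3; apply/boxE.
  by rewrite !ler_norml; split; move: h1 h2 h3 d1 d2 d3; rewrite !ltr_norml;
    case: (ger0P x0.1.1); case: (ger0P x0.1.2); case: (ger0P x0.2); lra.
have Qe x : Q x -> F x0 / 2 <= F x.
  move=> [[]]; rewrite /= !in_itv/= => q1 q2 q3; apply/ltW/he.
  split; [split|]; rewrite /ball/= ltr_norml; lra.
have iF : leb3.-integrable (box L) (EFin \o F) by exact: continuous_integrable_box.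
have mF : measurable_fun (box L : set M3) (EFin \o F) by exact: measurable_int iF.
have : (0 < \int[leb3]_(x in box L) (F x)%:E)%E.
  apply: (@lt_le_trans _ _ (\int[leb3]_(x in Q) (F x0 / 2)%:E)%E).
    rewrite integral_cst//= leb3_prod ?lebesgue_measure_itv//=.
    rewrite !lte_fin !ltrDl d0 -!EFinB -!EFinM lte_fin !mulr_gt0//; lra.
  apply: (@le_trans _ _ (\int[leb3]_(x in Q) (F x)%:E)%E).
    apply: ge0_le_integral => //.
    - by move=> x _; rewrite lee_fin; lra.
    - by apply: measurable_funS mF => //; exact: measurable_box.
  apply: ge0_subset_integral => //; exact: measurable_box.
rewrite -(@fineK _ (\int[leb3]_(x in box L) (F x)%:E)%E).
  by rewrite -/(Rintegral _ _ _) -/(boxint _ _) I0 ltxx.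
by apply: integrable_fin_num => //; exact: measurable_box.
Qed.

End BoxParam.

(** * Partial derivatives integrate to zero *)

Inductive axis := X1 | X2 | X3.

Section Divergence.
Context {R : realType}.
Notation R3 := (R3 R).
Notation M3 := (M3 R).
Notation leb := (@lebesgue_measure R).

Definition dir (i : axis) : R3 :=
  match i with X1 => (1, 0, 0) | X2 => (0, 1, 0) | X3 => (0, 0, 1) end.

Definition coord (i : axis) (x : R3) : R :=
  match i with X1 => x.1.1 | X2 => x.1.2 | X3 => x.2 end.

Lemma FTC_zero (L : R) (f f' : R -> R) : continuous f' ->
  (forall t, is_derive t (1 : R) f (f' t)) -> f L = 0 -> f (- L) = 0 -> 0 < L ->
  (\int[leb]_(t in `[(- L)%R, L]) (f' t)%:E = 0)%E.
Proof.
move=> cf' df fL fNL L0.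
have cf : continuous f.
  by move=> t; apply/differentiable_continuous/derivable1_diffP; case: (df t).
rewrite (@continuous_FTC2 _ f' f); first by rewrite fL fNL subee.
- lra.
- exact: continuous_subspaceT.
- split; first by move=> t _; case: (df t).
  + exact/cvg_at_right_filter/cf.
  + exact/cvg_at_left_filter/cf.
- by move=> t _; rewrite derive1E; exact: derive_val.
Qed.

(** Fubini's theorem asks for sigma-finite factors; R^3 is the product of this
plane and a line. *)
Definition leb2 : set (measurableTypeR R * measurableTypeR R) -> \bar R :=
  (leb \x leb)%E.
HB.instance Definition _ := Measure.copy leb2 (leb \x leb)%E.

Let sigma_finite_leb2 : sigma_finite setT leb2.
Proof.
exists (fun n => `[- n%:R, n%:R]%classic `*` `[- n%:R, n%:R]%classic).
  apply/seteqP; split=> // -[x y] _.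
  exists (Num.truncn (Num.max `|x| `|y|)).+1 => //; split; rewrite /= in_itv/= -ler_norml ltW//;
    by apply: le_lt_trans (truncnS_gt _); rewrite le_max lexx ?orbT.
move=> n; split; first by apply: measurableX; exact: measurable_itv.
rewrite [X in (X < _)%E](_ : _ = (leb `[(- n%:R)%R, n%:R%R] * leb `[(- n%:R)%R, n%:R%R])%E); last first.
  exact: product_measure1E.
rewrite !lebesgue_measure_itv//=.
by case: ifPn => _; rewrite ?mul0e// -!EFinB -!EFinM ltry.
Qed.

HB.instance Definition _ := Measure_isSigmaFinite.Build _ _ _ leb2 sigma_finite_leb2.

Section Fubini.
Context d1 d2 (T1 : measurableType d1) (T2 : measurableType d2).
Variables (m1 : {sigma_finite_measure set T1 -> \bar R})
  (m2 : {sigma_finite_measure set T2 -> \bar R}) (F : T1 * T2 -> \bar R).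
Hypothesis iF : (m1 \x m2)%E.-integrable setT F.

Lemma integral_prod_slice1_eq0 :
  (forall x, \int[m2]_y F (x, y) = 0)%E -> (\int[(m1 \x m2)%E]_z F z = 0)%E.
Proof.
move=> F0; rewrite -integral12_prod_meas1//.
by rewrite (eq_integral (cst 0%E)) ?integral0// => x _; exact: F0.
Qed.

Lemma integral_prod_slice2_eq0 :
  (forall y, \int[m1]_x F (x, y) = 0)%E -> (\int[(m1 \x m2)%E]_z F z = 0)%E.
Proof.
move=> F0; rewrite -integral21_prod_meas1//.
by rewrite (eq_integral (cst 0%E)) ?integral0// => y _; exact: F0.
Qed.
End Fubini.

(** Integrating first along the axis i reduces this to the fundamental theorem of
calculus on a segment at whose ends H vanishes. *)
Lemma boxint_dir_eq0 (L : R) (i : axis) (H H' : R3 -> R) : 0 < L ->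
  continuous H' -> (forall x, is_derive x (dir i) H (H' x)) ->
  (forall x, ~ (forall j, `|coord j x| < L) -> H x = 0) ->
  boxint L H' = 0.
Proof.
move=> L0 cH' dH H0.
have [M [_ hM]] : bounded_set (H' @` box L).
  apply: compact_bounded; apply: continuous_compact; last exact: compact_box.
  exact: continuous_subspaceT.
pose K := `|M| + 1.
have K0 : 0 <= K by rewrite addr_ge0.
have {hM}hM x : box L x -> `|H' x| <= K.
  by move=> Bx; apply: (hM K); [rewrite (le_lt_trans (ler_norm M))// ltrDl|exists x].
pose F : M3 -> \bar R := EFin \o (H' \_ (box L)).
have FK x : (`|F x| <= K%:E)%E.
  by rewrite /F/= patchE lee_fin; case: ifPn => [/set_mem/hM//|]; rewrite normr0.
have iF : leb3.-integrable setT F.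
  rewrite /F -restrict_EFin; apply/integrable_restrict => //.
    exact: measurable_box.
  by rewrite setTI; exact: continuous_integrable_box.
have mF : measurable_fun setT F by exact: measurable_int iF.
suff : (\int[leb3]_x F x = 0)%E.
  by rewrite /boxint Rintegral_mkcond /Rintegral => ->.
have FE x : F x = if [&& `|x.1.1| <= L, `|x.1.2| <= L & `|x.2| <= L] then (H' x)%:E else 0%E.
  rewrite /F/= patchE; case: ifPn => [/set_mem/boxE[-> -> ->]//|nB].
  case: ifPn => // /and3P[a b c]; case/negP: nB; apply/mem_set/boxE; split=> //.
have itvE : `[- L, L]%classic = [set t : R | `|t| <= L].
  by apply/seteqP; split => t /=; rewrite in_itv/= ler_norml.
have line (g g' : R -> R) (b : bool) (G : R -> \bar R) : continuous g' ->
  (forall t, is_derive t (1 : R) g (g' t)) -> g L = 0 -> g (- L) = 0 ->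
  (forall t, G t = if b && (`|t| <= L) then (g' t)%:E else 0%E) ->
  (\int[leb]_t G t = 0)%E.
  move=> cg dg gL gNL GE; case: b GE => GE; last first.
    by rewrite (eq_integral (cst 0%E)) ?integral0// => t _; rewrite GE.
  rewrite -(FTC_zero cg dg gL gNL L0) [RHS]integral_mkcond.
  apply: eq_integral => t _; rewrite GE patchE itvE/=.
  by congr (if _ then _ else _); rewrite mem_setE.
have dline (x : R3) (t : R) (g : R -> R3) : (forall h, g (h + t) = h *: dir i + g t) ->
    is_derive t (1 : R) (fun s => H (g s)) (H' (g t)).
  move=> gE; apply/der_line; have /der_line := dH (g t).
  by under eq_fun do rewrite -gE; under [X in _ -> is_derive _ _ X _]eq_fun do rewrite /GRing.scale /= mulr1.
have isq (z : R) : (leb \x leb)%E.-integrable setT (fun w => F (w, z)).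
  have -> : (fun w => F (w, z)) =
      (fun w => F (w, z)) \_ (`[- L, L] `*` `[- L, L]).
    apply/funext => w; rewrite patchE; case: ifPn => // nw.
    rewrite FE/=; case: ifPn => // /and3P[a b _]; case/negP: nw.
    by apply/mem_set; rewrite itvE.
  have mS : measurable (`[- L, L]%classic `*` `[- L, L]%classic : set (measurableTypeR R * measurableTypeR R)).
    by apply: measurableX; exact: measurable_itv.
  apply/integrable_restrict => //; rewrite setTI.
  apply: (@le_integrable _ _ _ _ _ _ _ (EFin \o cst K)) => //.
  - apply: (@measurable_funS _ _ _ _ setT) => //.
    exact: measurable_fun_pair1.
  - by move=> w _; rewrite /= (ger0_norm K0); exact: FK.
  - apply: measurable_bounded_integrable => //.
      rewrite [X in (X < _)%E](_ : _ = (leb `[(- L)%R, L] * leb `[(- L)%R, L])%E); last first.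
        exact: product_measure1E.
      rewrite !lebesgue_measure_itv//=.
      by case: ifPn => _; rewrite ?mul0e// -!EFinB -!EFinM ltry.
    by exists K; split; [exact: num_real|move=> N KN x _ /=; rewrite ger0_norm// ltW].
pose int1 := @integral_prod_slice1_eq0 _ _ _ _ leb2 leb.
pose int2 := @integral_prod_slice2_eq0 _ _ _ _ leb2 leb.
pose int1' := @integral_prod_slice1_eq0 _ _ _ _ leb leb.
pose int2' := @integral_prod_slice2_eq0 _ _ _ _ leb leb.
case: i dH dline => dH dline.
- apply: (int2 F iF) => z; apply: (int2' _ (isq z)) => y.
  apply: (line (fun x => H (x, y, z)) (fun x => H' (x, y, z)) ((`|y| <= L) && (`|z| <= L))).
  + by cont.
  + move=> t; apply: (dline (t, y, z) t (fun t => (t, y, z))) => h.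
    by transitivity (h * 1 + t, h * 0 + y, h * 0 + z); [rewrite mulr1 !mulr0 !add0r|].
  + by apply: H0 => /(_ X1)/=; rewrite gtr0_norm ?ltxx.
  + by apply: H0 => /(_ X1)/=; rewrite normrN gtr0_norm ?ltxx.
  + by move=> t; rewrite FE/= andbC.
- apply: (int2 F iF) => z; apply: (int1' _ (isq z)) => x.
  apply: (line (fun y => H (x, y, z)) (fun y => H' (x, y, z)) ((`|x| <= L) && (`|z| <= L))).
  + by cont.
  + move=> t; apply: (dline (x, t, z) t (fun t => (x, t, z))) => h.
    by transitivity (h * 0 + x, h * 1 + t, h * 0 + z); [rewrite mulr1 !mulr0 !add0r|].
  + by apply: H0 => /(_ X2)/=; rewrite gtr0_norm ?ltxx.
  + by apply: H0 => /(_ X2)/=; rewrite normrN gtr0_norm ?ltxx.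
  + by move=> t; rewrite FE/= -andbA [(`|z| <= L) && _]andbC.
- apply: (int1 F iF) => -[x y].
  apply: (line (fun z => H (x, y, z)) (fun z => H' (x, y, z)) ((`|x| <= L) && (`|y| <= L))).
  + by cont.
  + move=> t; apply: (dline (x, y, t) t (fun t => (x, y, t))) => h.
    by transitivity (h * 0 + x, h * 0 + y, h * 1 + t); [rewrite mulr1 !mulr0 !add0r|].
  + by apply: H0 => /(_ X3)/=; rewrite gtr0_norm ?ltxx.
  + by apply: H0 => /(_ X3)/=; rewrite normrN gtr0_norm ?ltxx.
  + by move=> t; rewrite FE/= -andbA.
Qed.

End Divergence.

(** * Continuous extension to the closure, and mixed derivatives *)

Section Extension.
Context {R : realType} {V : normedModType R}.
Variables (D : set V) (pr : V -> V).
Hypotheses (oD : open D) (cpr : continuous pr)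
  (prD : forall z, D z -> pr z = z) (prcl : forall z, closure D (pr z)).

(** As pr retracts the whole space onto the closure of D, a function that has limits
on the closure is extended to a continuous function on the whole space. *)
Definition ext (w : V -> R) (z : V) : R := lim (w @ within D (nbhs (pr z))).

Definition has_limits (w : V -> R) :=
  forall x, closure D x -> exists l : R, w @ within D (nbhs x) --> l.

Lemma ext_cvg w z : has_limits w -> w @ within D (nbhs (pr z)) --> ext w z.
Proof.
move=> hw; have [l wl] := hw _ (@prcl z).
have PF : ProperFilter (within D (nbhs (pr z))) by apply: within_nbhs_proper; exact: prcl.
by rewrite /ext (cvg_lim _ wl).
Qed.

Lemma ext_unique w z (l : R) : w @ within D (nbhs (pr z)) --> l -> ext w z = l.
Proof.
move=> wl.
have PF : ProperFilter (within D (nbhs (pr z))) by apply: within_nbhs_proper; exact: prcl.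
exact: cvg_lim.
Qed.

(** The filter of neighbourhoods within D of a point of D contains only sets
through that point, so a limit there is the value. *)
Lemma ext_in w z : has_limits w -> D z -> ext w z = w z.
Proof.
move=> hw Dz; have := ext_cvg (z := z) hw; rewrite prD// => H.
apply/eqP; rewrite -subr_eq0 -normr_le0; apply/ler_addgt0Pl => e e0.
rewrite addr0; have /cvgrPdist_le/(_ e e0) := H.
by move/nbhs_singleton; apply.
Qed.

(** Near z, the value of the extension is a limit of values of w at points of D
that are close to pr z. *)
Lemma ext_continuous w : has_limits w -> continuous (ext w).
Proof.
move=> hw z; apply/cvgrPdist_le => e e0.
have /cvgrPdist_le/(_ e e0) := ext_cvg (z := z) hw.
rewrite near_withinE => H.
have {}H : \forall a \near pr z, nbhs a [set y | D y -> `|ext w z - w y| <= e].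
  exact: nbhs_interior.
have : \forall z' \near z, nbhs (pr z') [set y | D y -> `|ext w z - w y| <= e].
  exact: (cpr H).
apply: filterS => z' H'.
have PF : ProperFilter (within D (nbhs (pr z'))) by apply: within_nbhs_proper; exact: prcl.
have C : `|ext w z - w y| @[y --> within D (nbhs (pr z'))] --> `|ext w z - ext w z'|.
  by apply: cvg_norm; apply: cvgB; [exact: cvg_cst|exact: ext_cvg].
by apply: (cvgr_to_le C); rewrite near_withinE.
Qed.

End Extension.

Section Schwarz.
Context {R : realType} {V : normedModType R}.

(** The mean value theorem is applied to the difference of u along two opposite
sides of the parallelogram, and then to the difference of uw that it produces. *)
Lemma square_increment (u uw uwv : V -> R) (x v w : V) (d : R) : 0 < d ->
  (forall h k, 0 <= h <= d -> 0 <= k <= d ->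
    is_derive (x + h *: v + k *: w) w u (uw (x + h *: v + k *: w)) /\
    is_derive (x + h *: v + k *: w) v uw (uwv (x + h *: v + k *: w))) ->
  exists h k, [/\ 0 <= h <= d, 0 <= k <= d &
    u (x + d *: v + d *: w) - u (x + 0 *: v + d *: w) -
    (u (x + d *: v + 0 *: w) - u (x + 0 *: v + 0 *: w)) =
    d * d * uwv (x + h *: v + k *: w)].
Proof.
move=> d0 H.
have line (g : V -> R) (g' : R) (y z : V) (k : R) :
    is_derive (y + k *: z) z g g' -> is_derive k (1 : R) (fun k => g (y + k *: z)) g'.
  move=> /der_line Hg; apply/der_line.
  rewrite (_ : (fun _ => _) = fun h : R => g (h *: z + (y + k *: z)))//.
  by apply/funext => h; rewrite -[h *: (1 : R)]/(h * 1) mulr1 scalerDl addrCA.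
have MV (f f' : R -> R) : (forall k, 0 <= k <= d -> is_derive k (1 : R) f (f' k)) ->
    exists2 k, 0 <= k <= d & f d - f 0 = f' k * d.
  move=> df; have [||k] := @MVT _ f f' 0 d d0.
  - move=> k; rewrite in_itv/= => /andP[k1 k2]; apply: df; rewrite !ltW//.
  - apply: derivable_within_continuous => k; rewrite in_itv/= => kd.
    by case: (df k kd).
  - by rewrite in_itv/= => /andP[k1 k2]; rewrite subr0 => ?; exists k; rewrite ?ltW.
have dd : 0 <= d <= d by rewrite ltW//=.
have zd : 0 <= (0 : R) <= d by rewrite lexx ltW.
have [k kd E1] := MV (fun k => u (x + d *: v + k *: w) - u (x + 0 *: v + k *: w))
  (fun k => uw (x + d *: v + k *: w) - uw (x + 0 *: v + k *: w)) (fun k kd =>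
   der_add (line _ _ _ _ _ (H _ _ dd kd).1) (der_opp (line _ _ _ _ _ (H _ _ zd kd).1))).
have [h hd E2] : exists2 h, 0 <= h <= d &
    uw (x + d *: v + k *: w) - uw (x + 0 *: v + k *: w) =
    uwv (x + h *: v + k *: w) * d.
  apply: (MV (fun h => uw (x + h *: v + k *: w))) => h hd.
  have := (H _ _ hd kd).2; rewrite addrAC => /line.
  by under eq_fun => ? do rewrite addrAC.
by exists h, k; split=> //; rewrite E1 E2; ring.
Qed.

(** Schwarz: both mixed derivatives are limits of the same increments. *)
Lemma mixed_derivatives_eq (D : set V) (u uv uw uvw uwv : V -> R) (x v w : V) :
  open D -> D x -> continuous uvw -> continuous uwv ->
  (forall y, D y -> is_derive y v u (uv y)) ->
  (forall y, D y -> is_derive y w u (uw y)) ->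
  (forall y, D y -> is_derive y w uv (uvw y)) ->
  (forall y, D y -> is_derive y v uw (uwv y)) -> uvw x = uwv x.
Proof.
move=> oD Dx c1 c2 dv dw dvw dwv.
apply/eqP; rewrite -subr_eq0 -normr_le0; apply/ler_addgt0Pl => e e0.
rewrite addr0.
have : \forall y \near x, [/\ D y, `|uvw x - uvw y| <= e / 2 & `|uwv x - uwv y| <= e / 2].
  have h1 : \forall y \near x, D y by exact: open_nbhs_nbhs.
  have h2 : \forall y \near x, `|uvw x - uvw y| <= e / 2.
    by have /cvgrPdist_le := c1 x; apply; lra.
  have h3 : \forall y \near x, `|uwv x - uwv y| <= e / 2.
    by have /cvgrPdist_le := c2 x; apply; lra.
  by near=> y; split; near: y.
case/nbhs_ballP => r /= r0 Hr.
pose d := r / (`|v| + `|w| + 1) / 2.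
have s0 : 0 < `|v| + `|w| + 1 by rewrite ltr_wpDl// addr_ge0.
have d0 : 0 < d by rewrite /d !divr_gt0.
have dr : d * (`|v| + `|w|) < r.
  rewrite /d (_ : r / _ / 2 * _ = r * ((`|v| + `|w|) / (2 * (`|v| + `|w| + 1)))); last by field; lra.
  rewrite gtr_pMr// ltr_pdivrMr; last lra.
  have := normr_ge0 v; have := normr_ge0 w; lra.
have inb h k : 0 <= h <= d -> 0 <= k <= d -> ball x r (x + h *: v + k *: w).
  move=> /andP[h0 hd] /andP[k0 kd]; rewrite -ball_normE /= -addrA (opprD x) addrA subrr add0r.
  rewrite normrN (le_lt_trans (ler_normD _ _))// !normrZ !ger0_norm//.
  rewrite (le_lt_trans _ dr)// mulrDr lerD// ler_wpM2r//.
have [h [k [hd kd E1]]] := square_increment (u := u) (uw := uw) (uwv := uwv) (x := x) (v := v) (w := w) d0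
  (fun h k hd kd => let: And3 Dy _ _ := Hr _ (inb h k hd kd) in conj (dw _ Dy) (dwv _ Dy)).
have inb' m n : 0 <= m <= d -> 0 <= n <= d -> ball x r (x + m *: w + n *: v).
  by move=> ? ?; rewrite addrAC; exact: inb.
have [h' [k' [hd' kd' E2]]] := square_increment (u := u) (uw := uv) (uwv := uvw) (x := x) (v := w) (w := v) d0
  (fun h k hd kd => let: And3 Dy _ _ := Hr _ (inb' h k hd kd) in conj (dv _ Dy) (dvw _ Dy)).
have E : uwv (x + h *: v + k *: w) = uvw (x + h' *: w + k' *: v).
  have dd : d * d != 0 by rewrite mulf_neq0// gt_eqF.
  apply: (mulfI dd); rewrite -E1 -E2.
  rewrite ![x + _ *: w + _ *: v]addrAC.
  by ring.
have [_ _ A] := Hr _ (inb h k hd kd).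
have [_ B _] := Hr _ (inb' h' k' hd' kd').
rewrite E in A.
rewrite (_ : uvw x - uwv x = (uvw x - uvw (x + h' *: w + k' *: v)) - (uwv x - uvw (x + h' *: w + k' *: v))); last by ring.
by rewrite (le_trans (ler_normB _ _))// (splitr e) lerD.
Unshelve. all: by end_near. Qed.

End Schwarz.

(** * Solutions and their derivatives extended to the initial time *)

Section Jets.
Context {R : realType}.
Notation R3 := (R3 R).

Definition e_x (i : axis) : R3 * R := (dir i, 0).

(** A solution with its derivatives of order at most two, as functions continuous
on the whole space-time. The derivatives are required to be derivatives for t > 0
only; continuity is what connects them with the data at t = 0. *)
Record wave_jet (c f : R3 -> R) (u ut utt : R3 * R -> R)
    (ux utx uxx : axis -> R3 * R -> R) : Prop := WaveJet {
  jet_u : continuous u;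
  jet_ut : continuous ut;
  jet_utt : continuous utt;
  jet_ux : forall i, continuous (ux i);
  jet_utx : forall i, continuous (utx i);
  jet_uxx : forall i, continuous (uxx i);
  jet_u_t : forall (x : R3) (t : R), 0 < t -> is_derive t (1 : R) (fun s => u (x, s)) (ut (x, t));
  jet_ut_t : forall (x : R3) (t : R), 0 < t -> is_derive t (1 : R) (fun s => ut (x, s)) (utt (x, t));
  jet_ux_t : forall i (x : R3) (t : R), 0 < t ->
    is_derive t (1 : R) (fun s => ux i (x, s)) (utx i (x, t));
  jet_u_x : forall i (x : R3) (t : R), 0 < t ->
    is_derive x (dir i) (fun y => u (y, t)) (ux i (x, t));
  jet_ut_x : forall i (x : R3) (t : R), 0 < t ->
    is_derive x (dir i) (fun y => ut (y, t)) (utx i (x, t));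
  jet_ux_x : forall i (x : R3) (t : R), 0 < t ->
    is_derive x (dir i) (fun y => ux i (y, t)) (uxx i (x, t));
  jet_wave : forall (x : R3) (t : R), 0 < t ->
    utt (x, t) = c x ^+ 2 * (uxx X1 (x, t) + uxx X2 (x, t) + uxx X3 (x, t));
  jet_u0 : forall x, u (x, 0) = f x;
  jet_ut0 : forall x, ut (x, 0) = 0
}.

Lemma der_time (u : R3 * R -> R) x t a :
  is_derive (x, t) e_t u a -> is_derive t (1 : R) (fun s => u (x, s)) a.
Proof.
move=> /der_line du; apply/der_line; move: du.
rewrite (_ : (fun _ => _) = (fun h : R => u (x, h *: (1 : R) + t)))//.
apply/funext => h; congr u.
transitivity ((h * 0 + x.1.1, h * 0 + x.1.2, h * 0 + x.2), h * 1 + t) => //.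
by rewrite mulr0 !add0r; case: x => [[]].
Qed.

Lemma der_space (u : R3 * R -> R) i x t a :
  is_derive (x, t) (e_x i) u a <-> is_derive x (dir i) (fun y => u (y, t)) a.
Proof.
have E : (fun h : R => u (h *: e_x i + (x, t))) = (fun h : R => u (h *: dir i + x, t)).
  apply/funext => h; congr u.
  transitivity (h *: dir i + x, h * 0 + t) => //.
  by rewrite mulr0 add0r.
by split => /der_line d; apply/der_line; move: d; rewrite E.
Qed.

Section HalfSpace.
Variables (k b : R) (D : set (R3 * R)) (p : R3 * R -> R) (c f : R3 -> R).
Hypotheses (k2 : k * k = 1) (DE : forall z, D z <-> 0 < k * (z.2 - b))
  (solp : wave_solution c D b f p).

Let tau (t : R) := k * t + b.
(** The distance in time to the boundary of D, counted positively inside D, is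
truncated at zero. *)
Let pr (z : R3 * R) := (z.1, tau (Num.max (k * (z.2 - b)) 0)).

Let Dtau x t : 0 < t -> D (x, tau t).
Proof. by move=> t0; apply/DE; rewrite /tau /= addrK mulrA k2 mul1r. Qed.

Let oD : open D.
Proof.
have -> : D = (fun z : R3 * R => k * (z.2 - b)) @^-1` [set t | 0 < t].
  by apply/seteqP; split => z /DE.
apply: open_comp; last exact: open_gt.
move=> z _; move: z; rewrite -/(continuous (fun z : R3 * R => k * (z.2 - b))); cont.
Qed.

Let cpr : continuous pr.
Proof. rewrite /pr /tau; cont. Qed.

Let prD z : D z -> pr z = z.
Proof.
move=> /DE Dz; rewrite /pr /tau max_l ?ltW// mulrA k2 mul1r subrK.
by case: z {Dz}.
Qed.

Let pr_tau x t : 0 <= t -> pr (x, tau t) = (x, tau t).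
Proof.
by move=> t0; rewrite /pr {1}/tau /= /tau addrK mulrA k2 mul1r max_l.
Qed.

Let prcl z : closure D (pr z).
Proof.
move=> B; rewrite /pr; set m := Num.max _ _ => nB.
have m0 : 0 <= m by rewrite le_max lexx orbT.
have cl : continuous (fun s : R => (z.1, tau s) : R3 * R) by rewrite /tau; cont.
have /nbhs_ballP[e /= e0 He] := cl m _ nB.
exists (z.1, tau (m + e / 2)); split.
  by apply: Dtau; lra.
by apply: He; rewrite /ball /= ltr_norml; lra.
Qed.

Let lim_p s : (size s <= 2)%N -> has_limits D (iter_derive s p).
Proof. by case: solp => Ck _ _ _ /Ck[]. Qed.

Let U s := ext D pr (iter_derive s p).

Let cU s : (size s <= 2)%N -> continuous (U s).
Proof.
by move=> s2; apply: (ext_continuous cpr prcl); exact: lim_p.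
Qed.

Let U_in s z : (size s <= 2)%N -> D z -> U s z = iter_derive s p z.
Proof. by move=> s2; apply: (ext_in prD prcl); exact: lim_p. Qed.

Let dU s z v : (size s < 2)%N -> D z -> is_derive z v (U s) (U (v :: s) z).
Proof.
move=> s2 Dz; apply: (near_eq_is_derive (f := iter_derive s p)).
  have : \forall y \near z, D y by exact: open_nbhs_nbhs.
  by apply: filterS => y Dy; rewrite U_in// ltnW.
rewrite U_in//=; apply: derivableP.
by case: solp => Ck _ _ _; have [+ _] := Ck s (ltnW s2); exact.
Qed.

Let dU_time (s : seq (R3 * R)) (x : R3) (t : R) : (size s < 2)%N -> 0 < t ->
  is_derive t (1 : R) (fun r => U s (x, tau r)) (k * U (e_t :: s) (x, tau t)).
Proof.
move=> s2 t0; rewrite mulrC.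
apply: (der_comp (f := fun r => U s (x, r)) (g := tau)).
  by apply: der_time; apply: dU => //; exact: Dtau.
have := der_add (der_mul (der_cst t 1 k) (der_id t)) (der_cst t (1 : R) b).
by rewrite mul0r mulr1 add0r addr0.
Qed.

Let dU_space (s : seq (R3 * R)) (x : R3) (t : R) i : (size s < 2)%N -> 0 < t ->
  is_derive x (dir i) (fun y => U s (y, tau t)) (U (e_x i :: s) (x, tau t)).
Proof.
by move=> s2 t0; apply/der_space; apply: dU => //; exact: Dtau.
Qed.

Let dU_mixed i (x : R3) (t : R) : 0 < t ->
  U [:: e_x i; e_t] (x, tau t) = U [:: e_t; e_x i] (x, tau t).
Proof.
move=> t0; apply: (mixed_derivatives_eq (D := D) (u := U [::]) (v := e_t) (w := e_x i)
  (uv := U [:: e_t]) (uw := U [:: e_x i])) => //; try exact: cU.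
all: try exact: Dtau.
all: by move=> y Dy; exact: dU.
Qed.

Let cshift (w : R3 * R -> R) : continuous w -> continuous (fun z => w (z.1, tau z.2)).
Proof. by move=> cw; rewrite /tau; cont. Qed.

(** Reading a solution through the time map t |-> k t + b, with k = 1 or -1,
turns initial and final value problems into the same one. *)
Lemma half_space_jet : exists u ut utt ux utx uxx,
  wave_jet c f u ut utt ux utx uxx /\
  forall (x : R3) (t : R), 0 < t -> u (x, t) = p (x, k * t + b).
Proof.
pose sh w (z : R3 * R) : R := w (z.1, tau z.2).
have cm (w : R3 * R -> R) : continuous w -> continuous (fun z => k * w z) by move=> cw; cont.
exists (sh (U [::])), (fun z => k * sh (U [:: e_t]) z), (sh (U [:: e_t; e_t])).
exists (fun i => sh (U [:: e_x i])), (fun i z => k * sh (U [:: e_x i; e_t]) z).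
exists (fun i => sh (U [:: e_x i; e_x i])).
split; last by move=> x t t0; rewrite /sh U_in//; exact: Dtau.
split=> //.
- by apply: cshift; exact: cU.
- by apply: cm; apply: cshift; exact: cU.
- by apply: cshift; exact: cU.
- by move=> i; apply: cshift; exact: cU.
- by move=> i; apply: cm; apply: cshift; exact: cU.
- by move=> i; apply: cshift; exact: cU.
- by move=> x t t0; exact: dU_time.
- move=> x t t0; have := der_mul (der_cst t 1 k) (dU_time x (s := [:: e_t]) isT t0).
  by rewrite mul0r add0r mulrA k2 mul1r.
- by move=> i x t t0; rewrite /sh /= dU_mixed//; exact: dU_time.
- by move=> i x t t0; exact: dU_space.
- move=> i x t t0; have := der_mul (der_cst x (dir i) k) (dU_space x i (s := [:: e_t]) isT t0).
  by rewrite mul0r add0r.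
- by move=> i x t t0; exact: dU_space.
- move=> x t t0; rewrite /sh /= !U_in//; try exact: Dtau.
  by case: solp => _ /(_ x (tau t) (Dtau x t0)) /eqP; rewrite subr_eq0 => /eqP.
- move=> x; case: solp => _ _ /(_ x) pf _; rewrite /sh; apply: (ext_unique prcl).
  by rewrite pr_tau// /tau mulr0 add0r.
- move=> x; case: solp => _ _ _ /(_ x) pf; rewrite /sh (_ : U _ _ = 0) ?mulr0//.
  by apply: (ext_unique prcl); rewrite pr_tau// /tau mulr0 add0r.
Qed.

End HalfSpace.

Lemma initial_jet (c f : R3 -> R) p : initial_solution c f p ->
  exists u ut utt ux utx uxx, wave_jet c f u ut utt ux utx uxx /\
  forall (x : R3) (t : R), 0 < t -> u (x, t) = p (x, t).
Proof.
move=> sp; have := @half_space_jet 1 0 _ p c f (mulr1 1) _ sp.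
case=> [|u [ut [utt [ux [utx [uxx [J E]]]]]]].
  by move=> z /=; rewrite mul1r subr0.
exists u, ut, utt, ux, utx, uxx; split=> // x t t0.
by rewrite E// mul1r addr0.
Qed.

Lemma final_jet (c g : R3 -> R) (T : R) q : final_solution c T g q ->
  exists u ut utt ux utx uxx, wave_jet c g u ut utt ux utx uxx /\
  forall (x : R3) (t : R), 0 < t -> u (x, t) = q (x, T - t).
Proof.
move=> sq; have k2 : (-1 : R) * -1 = 1 by rewrite mulrNN mulr1.
have := @half_space_jet (-1) T _ q c g k2 _ sq.
case=> [|u [ut [utt [ux [utx [uxx [J E]]]]]]].
  by move=> z /=; rewrite mulN1r opprB subr_gt0.
exists u, ut, utt, ux, utx, uxx; split=> // x t t0.
by rewrite E// mulN1r addrC.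
Qed.

End Jets.

(** * Finite speed of propagation *)

Section Propagation.
Context {R : realType}.
Notation R3 := (R3 R).

(** The gradient at time zero is only a limit from positive times, where the mean
value theorem controls increments of u(., t); letting t tend to 0 compares them
with the increments of f. *)
Lemma jet_ux0 (c f : R3 -> R) u ut utt ux utx uxx (i : axis) (x : R3) :
  wave_jet c f u ut utt ux utx uxx -> (\forall y \near x, f y = 0) ->
  ux i (x, 0) = 0.
Proof.
move=> J f0; apply/eqP; rewrite -normr_le0; apply/ler_addgt0Pl => e e0.
rewrite addr0.
pose g (z : R * R) : R3 * R := (z.1 *: dir i + x, z.2).
have g0 : g (0, 0) = (x, 0) by rewrite /g /= scale0r add0r.
have cg : continuous g.
  apply: cont_pair; last exact: (cont_snd (@cont_id _)).
  move=> z; apply: cvgD; last exact: cvg_cst.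
  by apply: cvgZr_tmp; exact: cvg_fst.
have h1 : \forall z \near (0 : R * R), `|ux i (x, 0) - ux i (g z)| <= e.
  have cux := jet_ux J; have cug : continuous (fun z => ux i (g z)) by cont.
  have /cvgrPdist_le := cug (0, 0); rewrite g0; exact.
have h2 : \forall z \near (0 : R * R), f (g z).1 = 0.
  have cg1 : continuous (fun z => (g z).1) by exact: cont_fst.
  by have := cg1 (0, 0); rewrite /continuous_at g0 => /(_ _ f0).
have /nbhs_ballP[r /= r0 Hr] : \forall z \near (0 : R * R),
    `|ux i (x, 0) - ux i (g z)| <= e /\ f (g z).1 = 0.
  by near=> z; split; near: z.
have {}Hr s t : 0 <= s < r -> 0 <= t < r ->
    `|ux i (x, 0) - ux i (s *: dir i + x, t)| <= e /\ f (s *: dir i + x) = 0.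
  move=> /andP[s0 sr] /andP[t0 tr]; apply: (Hr (s, t)).
  by split; rewrite /ball /= sub0r normrN ger0_norm.
pose h := r / 2.
have hpos : 0 < h by rewrite /h divr_gt0.
have hr : h < r by rewrite /h; lra.
suff : `|h * ux i (x, 0)| <= e * h.
  by rewrite normrM gtr0_norm// mulrC ler_pM2r.
have K t : 0 < t < r ->
    `|u (h *: dir i + x, t) - u (x, t) - h * ux i (x, 0)| <= e * h.
  move=> /andP[t0 tr].
  have D s : is_derive s (1 : R) (fun s => u (s *: dir i + x, t)) (ux i (s *: dir i + x, t)).
    have /der_line := jet_u_x J i (s *: dir i + x) t0 => du; apply/der_line; move: du.
    rewrite (_ : (fun _ => _) = (fun a => u ((a *: (1 : R) + s) *: dir i + x, t)))//.
    by apply/funext => a; rewrite -[a *: (1 : R)]/(a * 1) mulr1 scalerDl addrA.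
  have [|s + E] := @MVT _ (fun s => u (s *: dir i + x, t)) (fun s => ux i (s *: dir i + x, t)) 0 h hpos (fun s _ => D s).
  - by apply: derivable_within_continuous => s _; case: (D s).
  rewrite in_itv/= => /andP[s0 sh].
  rewrite scale0r add0r subr0 in E; rewrite E.
  have sr : 0 <= s < r by rewrite (ltW s0) (lt_trans sh).
  have tr' : 0 <= t < r by rewrite (ltW t0).
  have [le_e _] := Hr s t sr tr'.
  by rewrite mulrC -mulrBr normrM gtr0_norm// mulrC ler_pM2r// distrC.
have E0 : u (h *: dir i + x, 0) - u (x, 0) = 0.
  have zr : 0 <= (0 : R) < r by rewrite lexx.
  have hr' : 0 <= h < r by rewrite (ltW hpos).
  have [_ fh] := Hr h 0 hr' zr; have [_ fx] := Hr 0 0 zr zr.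
  by rewrite scale0r add0r in fx; rewrite !(jet_u0 J) fh fx subrr.
have cu := jet_u J.
have C : continuous (fun t => `|u (h *: dir i + x, t) - u (x, t) - h * ux i (x, 0)|).
  apply: (@cont_comp _ _ _ (fun t => u (h *: dir i + x, t) - u (x, t) - h * ux i (x, 0)) Num.norm).
    exact: norm_continuous.
  by cont.
have := cvg_at_right_filter (C 0).
rewrite E0 sub0r normrN => C'; apply: (cvgr_to_le C').
near=> t; apply: K; apply/andP; split; near: t; [exact: nbhs_right_gt|exact: nbhs_right_lt].
Unshelve. all: by end_near. Qed.

(** The flux through the side of the cone is at most the energy swept by it:
Cauchy's inequality, with wave speed b at most M. *)
Lemma flux_le (M s b ut y1 y2 y3 p1 p2 p3 : R) : 0 < s -> 0 < b <= M ->
  y1 ^+ 2 + y2 ^+ 2 + y3 ^+ 2 <= s ^+ 2 ->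
  4 * (y1 * p1 + y2 * p2 + y3 * p3) * ut <=
  2 * M * s * (ut ^+ 2 / b ^+ 2 + p1 ^+ 2 + p2 ^+ 2 + p3 ^+ 2).
Proof.
move=> s0 /andP[b0 bM] ys.
pose a := ut / b; pose q := y1 * p1 + y2 * p2 + y3 * p3.
pose P := p1 ^+ 2 + p2 ^+ 2 + p3 ^+ 2.
have -> : ut ^+ 2 / b ^+ 2 + p1 ^+ 2 + p2 ^+ 2 + p3 ^+ 2 = a ^+ 2 + P.
  by rewrite /a /P exprMn exprVn !addrA.
have -> : 4 * (y1 * p1 + y2 * p2 + y3 * p3) * ut = 4 * b * (a * q).
  by rewrite /a /q; field; rewrite gt_eqF.
have P0 : 0 <= P by rewrite /P !addr_ge0// sqr_ge0.
have qP : q ^+ 2 <= s ^+ 2 * P.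
  apply: (@le_trans _ _ ((y1 ^+ 2 + y2 ^+ 2 + y3 ^+ 2) * P)); last by rewrite ler_wpM2r.
  rewrite -subr_ge0.
  have -> : (y1 ^+ 2 + y2 ^+ 2 + y3 ^+ 2) * P - q ^+ 2 =
    (y1 * p2 - y2 * p1) ^+ 2 + (y1 * p3 - y3 * p1) ^+ 2 + (y2 * p3 - y3 * p2) ^+ 2.
    by rewrite /P /q; ring.
  by rewrite !addr_ge0// sqr_ge0.
have aq : 2 * (a * q) <= s * (a ^+ 2 + P).
  rewrite -(ler_pM2l s0) -subr_ge0.
  have -> : s * (s * (a ^+ 2 + P)) - s * (2 * (a * q)) =
    (s * a - q) ^+ 2 + (s ^+ 2 * P - q ^+ 2) by ring.
  by rewrite addr_ge0 ?sqr_ge0 ?subr_ge0.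
have e0 : 0 <= s * (a ^+ 2 + P) by rewrite mulr_ge0 ?(ltW s0)// addr_ge0 ?sqr_ge0.
apply: (@le_trans _ _ (2 * b * (s * (a ^+ 2 + P)))).
  rewrite (_ : 4 * b * (a * q) = 2 * b * (2 * (a * q))); last by ring.
  by rewrite ler_wpM2l// mulr_ge0 ?ltW.
by rewrite -[leRHS]mulrA ler_wpM2r// ler_wpM2l.
Qed.

Section Cone.
Variables (c f : R3 -> R) (u ut utt : R3 * R -> R).
Variables (ux utx uxx : axis -> R3 * R -> R).
Variables (M T s : R) (x0 : R3).
Hypotheses (J : wave_jet c f u ut utt ux utx uxx) (cc : continuous c)
  (c0M : forall x, 0 < c x <= M) (T0 : 0 < T) (s0 : 0 < s) (sT : 2 * M * T < s).

(** The speed at which the square of the radius shrinks: the constant of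
flux_le. *)
Let K := 2 * M * s.
Let y i (x : R3) : R := coord i x - coord i x0.
Let rho x : R := y X1 x ^+ 2 + y X2 x ^+ 2 + y X3 x ^+ 2.

Hypothesis f0 : forall x, rho x < s ^+ 2 -> \forall y \near x, f y = 0.

(** Squared, this is the weight: it lives on |x - x0|^2 < s^2 - K t. *)
Let m (z : R3 * R) : R := Num.max (s ^+ 2 - K * z.2 - rho z.1) 0.
Let phi z : R := m z ^+ 2.
Let e z : R := ut z ^+ 2 / c z.1 ^+ 2 + ux X1 z ^+ 2 + ux X2 z ^+ 2 + ux X3 z ^+ 2.
Let F z : R := phi z * e z.
Let phi_t z : R := 2 * m z * - K.
Let phi_x i z : R := 2 * m z * - (2 * y i z.1).
Let F_t z : R := phi_t z * e z + phi z * (2 * ut z * utt z / c z.1 ^+ 2 +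
  2 * ux X1 z * utx X1 z + 2 * ux X2 z * utx X2 z + 2 * ux X3 z * utx X3 z).

Let c_neq0 x : c x != 0. Proof. by case/andP: (c0M x) => /gt_eqF ->. Qed.

Let M0 : 0 < M.
Proof. by case/andP: (c0M x0) => ? /(lt_le_trans _); apply. Qed.

Let K0 : 0 < K. Proof. by rewrite !mulr_gt0. Qed.

Let cinv : continuous (fun x => (c x ^+ 2)^-1).
Proof. by apply: cont_inv => [x|]; [rewrite expf_neq0|cont]. Qed.

Let ccoord i : continuous (@coord R i).
Proof. by case: i; rewrite /coord; cont. Qed.

Let cy i : continuous (y i).
Proof. by rewrite /y; have h := @ccoord i; cont. Qed.

Let crho : continuous rho.
Proof. by rewrite /rho; have h := cy; cont. Qed.

Let cm : continuous m.
Proof. by rewrite /m; have h := crho; cont. Qed.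

Let ce : continuous e.
Proof.
rewrite /e; have h1 := cinv; have h2 := jet_ut J; have h3 := jet_ux J.
cont; exact: (@cont_comp _ _ _ (fun z : R3 * R => z.1) _ h1 (cont_fst (@cont_id _))).
Qed.

Let cF : continuous F.
Proof. by rewrite /F /phi; have h1 := cm; have h2 := ce; cont. Qed.

Let cF_t : continuous F_t.
Proof.
rewrite /F_t /phi_t /phi; have h1 := cinv; have h2 := jet_ut J; have h3 := jet_ux J.
have h4 := jet_utt J; have h5 := jet_utx J; have h6 := cm; have h7 := ce.
cont; exact: (@cont_comp _ _ _ (fun z : R3 * R => z.1) _ h1 (cont_fst (@cont_id _))).
Qed.

Let dphi_t (x : R3) (t : R) : is_derive t (1 : R) (fun r => phi (x, r)) (phi_t (x, t)).
Proof.
apply: (der_scalar_comp (h := fun r => Num.max r 0 ^+ 2)).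
  exact: der_pos2.
have := der_add (der_add (der_cst t (1 : R) (s ^+ 2))
  (der_opp (der_mul (der_cst t (1 : R) K) (der_id t)))) (der_cst t (1 : R) (- rho x)).
by rewrite mul0r mulr1 !add0r addr0.
Qed.

Let dcoord i j x : is_derive x (dir i) (@coord R j) (coord j (dir i)).
Proof.
apply/der_line.
rewrite (_ : (fun _ => _) = (fun h : R => h * coord j (dir i) + coord j x)).
  have := der_add (der_mul (der_id (0 : R)) (der_cst 0 (1 : R) (coord j (dir i))))
    (der_cst 0 (1 : R) (coord j x)).
  by rewrite mul1r mulr0 !addr0.
by apply/funext => h; case: j.
Qed.

Let dphi_x i (x : R3) (t : R) :
  is_derive x (dir i) (fun z => phi (z, t)) (phi_x i (x, t)).
Proof.
apply: (der_scalar_comp (h := fun r => Num.max r 0 ^+ 2)).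
  exact: der_pos2.
have dy j : is_derive x (dir i) (y j) (coord j (dir i)).
  have := der_add (dcoord i j x) (der_cst x (dir i) (- coord j x0)).
  by rewrite addr0.
have := der_add (der_cst x (dir i) (s ^+ 2 - K * t)) (der_opp (der_add (der_add
  (der_exp2 (dy X1)) (der_exp2 (dy X2))) (der_exp2 (dy X3)))).
move=> H; apply: (is_derive_eq H).
by case: i {dy H}; rewrite /= !mulr1 !mulr0 ?add0r ?addr0.
Qed.

Let dF (x : R3) (t : R) : 0 < t -> is_derive t (1 : R) (fun r => F (x, r)) (F_t (x, t)).
Proof.
move=> t0.
have dux i := der_exp2 (jet_ux_t J i x t0).
have dut := der_mul (der_exp2 (jet_ut_t J x t0)) (der_cst t (1 : R) (c x ^+ 2)^-1).
have H := der_mul (dphi_t x t) (der_add (der_add (der_add dut (dux X1)) (dux X2)) (dux X3)).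
by apply: (is_derive_eq H); rewrite /F_t /e /= mulr0 addr0.
Qed.

Let flux i z : R := phi z * (ut z * ux i z).
Let flux_x i z : R := phi_x i z * (ut z * ux i z) +
  phi z * (utx i z * ux i z + ut z * uxx i z).

Let dflux i (x : R3) (t : R) : 0 < t ->
  is_derive x (dir i) (fun z => flux i (z, t)) (flux_x i (x, t)).
Proof.
by move=> t0; apply: der_mul => //; apply: der_mul; [exact: jet_ut_x J _ _ _ t0|exact: jet_ux_x J _ _ _ t0].
Qed.

(** The part of the derivative of the weighted energy density that is not the
divergence of 2 (flux X1, flux X2, flux X3). *)
Let loss z : R := phi_t z * e z -
  2 * (ut z * (phi_x X1 z * ux X1 z + phi_x X2 z * ux X2 z + phi_x X3 z * ux X3 z)).

Let F_tE (x : R3) (t : R) : 0 < t ->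
  F_t (x, t) = loss (x, t) + (2 * flux_x X1 (x, t) + 2 * flux_x X2 (x, t) + 2 * flux_x X3 (x, t)).
Proof.
move=> t0; rewrite /F_t /loss /flux_x (jet_wave J x t0) /=.
by field; exact: c_neq0.
Qed.

Let loss_le0 (x : R3) (t : R) : 0 <= t -> loss (x, t) <= 0.
Proof.
move=> t0.
have -> : loss (x, t) = 2 * m (x, t) * (4 * (y X1 x * ux X1 (x, t) +
    y X2 x * ux X2 (x, t) + y X3 x * ux X3 (x, t)) * ut (x, t) - K * e (x, t)).
  by rewrite /loss /phi_t /phi_x /=; ring.
rewrite /m /=; case: (lerP (s ^+ 2 - K * t - rho x) 0) => h; first by rewrite mulr0 mul0r.
rewrite pmulr_rle0 ?mulr_gt0// subr_le0 /K /e /=; apply: flux_le => //.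
have : 0 <= K * t by rewrite mulr_ge0// ltW.
rewrite -/(rho x); lra.
Qed.

Let L := `|coord X1 x0| + `|coord X2 x0| + `|coord X3 x0| + s.

Let phi_out (x : R3) (t : R) : 0 <= t -> ~ (forall j, `|coord j x| < L) -> phi (x, t) = 0.
Proof.
move=> t0 out; rewrite /phi /m max_r ?expr0n//= leNgt; apply/negP => h; apply: out.
have Kt : 0 <= K * t by rewrite mulr_ge0// ltW.
have yL j : `|y j x| < s.
  rewrite -(@ltr_pXn2r _ 2) ?nnegrE ?normr_ge0 ?(ltW s0)//.
  rewrite real_normK ?num_real//.
  have rge : y j x ^+ 2 <= rho x.
    by have := sqr_ge0 (y X1 x); have := sqr_ge0 (y X2 x); have := sqr_ge0 (y X3 x);
      rewrite /rho; case: j; lra.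
  by move: h; lra.
move=> j; have -> : coord j x = y j x + coord j x0 by rewrite /y subrK.
rewrite (le_lt_trans (ler_normD _ _))//.
have := yL j; have := normr_ge0 (coord X1 x0); have := normr_ge0 (coord X2 x0).
by have := normr_ge0 (coord X3 x0); rewrite /L; case: j; lra.
Qed.

Let L0 : 0 < L. Proof. by rewrite /L ltr_wpDl// !addr_ge0. Qed.

Let cflux_x i (t : R) : continuous (fun x => flux_x i (x, t)).
Proof.
rewrite /flux_x /phi_x /phi; have h2 := jet_ut J; have h3 := jet_ux J.
have h4 := jet_uxx J; have h5 := jet_utx J; have h6 := cm; have h7 := cy.
by cont.
Qed.

Let closs (t : R) : continuous (fun x => loss (x, t)).
Proof.
rewrite /loss /phi_x /phi_t /phi; have h2 := jet_ut J; have h3 := jet_ux J.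
by have h6 := cm; have h7 := cy; have h8 := ce; cont.
Qed.

Let E (t : R) := boxint L (fun x => F (x, t)).

Let dE (t : R) : 0 < t -> is_derive t (1 : R) E (boxint L (fun x => F_t (x, t))).
Proof.
move=> t0; apply: (is_derive_boxint (u := 0) (v := t + 1)) => //; first by lra.
by move=> x r _ /andP[r0 _]; exact: dF.
Qed.

Let E'_le0 (t : R) : 0 < t -> boxint L (fun x => F_t (x, t)) <= 0.
Proof.
move=> t0.
have cfl i : continuous (fun x => 2 * flux_x i (x, t)).
  by have h := @cflux_x i t; apply: cont_mul => //; exact: cont_cst.
have fl0 i : boxint L (fun x => 2 * flux_x i (x, t)) = 0.
  apply: (@boxint_dir_eq0 _ L i (fun x => 2 * flux i (x, t))) => //.
    move=> x; have := der_mul (der_cst x (dir i) 2) (dflux i x t0).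
    by rewrite mul0r add0r.
  by move=> x out; rewrite /flux phi_out ?mul0r ?mulr0 ?ltW.
rewrite (@eq_boxint _ L _ (fun x => loss (x, t) +
  (2 * flux_x X1 (x, t) + 2 * flux_x X2 (x, t) + 2 * flux_x X3 (x, t)))); last first.
  by move=> x _; exact: F_tE.
have c2 := cont_add (cfl X1) (cfl X2); have c3 := cont_add c2 (cfl X3).
have cl := @closs t.
rewrite (boxintD L cl c3) (boxintD L c2 (cfl X3)) (boxintD L (cfl X1) (cfl X2)).
rewrite !fl0 !addr0 -oppr_ge0.
have -> : - boxint L (fun x => loss (x, t)) = boxint L (fun x => -1 * loss (x, t)).
  by rewrite boxintZ// mulN1r.
by apply: boxint_ge0 => x _; rewrite mulN1r oppr_ge0 loss_le0// ltW.
Qed.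

Let F_ge0 z : 0 <= F z.
Proof.
by rewrite /F mulr_ge0 ?sqr_ge0// /e !addr_ge0 ?sqr_ge0// divr_ge0 ?sqr_ge0.
Qed.

Let E0 : E 0 = 0.
Proof.
rewrite /E (@eq_boxint _ L _ (fun=> 0)) ?boxint0// => x _.
rewrite /F /phi /m /= mulr0 subr0.
case: (lerP (s ^+ 2 - rho x) 0) => h; first by rewrite expr0n mul0r.
rewrite /e (jet_ut0 J) !(jet_ux0 _ J); first by rewrite expr0n mul0r !addr0 mulr0.
all: by apply: f0; lra.
Qed.

Let E_eq0 t : 0 <= t <= T -> E t = 0.
Proof.
move=> /andP[t0 tT]; apply/eqP; rewrite eq_le boxint_ge0 ?andbT//.
rewrite -[leRHS]E0.
have cE : continuous E by exact: continuous_boxint.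
apply: (@ler0_derive1_le_cc _ E 0 T) => //; rewrite ?in_itv/= ?lexx ?t0 ?tT ?(ltW T0)//.
- by move=> r; rewrite in_itv/= => /andP[r0 _]; case: (dE r0).
- move=> r; rewrite in_itv/= => /andP[r0 _].
  rewrite derive1E; have [_ ->] := dE r0; exact: E'_le0.
- exact: continuous_subspaceT.
Qed.

(** Zero weighted energy forces u_t (x0, t) = 0, since the weight at x0 is
(s^2 - K t)^2, positive up to time s / (2 M). This is half the sharp time s / M:
the price of a weight that is a polynomial in x inside its support. *)
Lemma finite_propagation (t : R) : 0 <= t <= T -> u (x0, t) = 0.
Proof.
move=> /andP[t0 tT].
have ut0 r : 0 <= r <= T -> ut (x0, r) = 0.
  move=> /andP[r0 rT].
  have Lx j : `|coord j x0| < L.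
    have := normr_ge0 (coord X1 x0); have := normr_ge0 (coord X2 x0).
    by have := normr_ge0 (coord X3 x0); move: s0; rewrite /L; case: j; lra.
  have : F (x0, r) = 0.
    apply: (boxint_eq0_pt (L := L) (F := fun x => F (x, r))) => //.
    - exact: continuous_slice.
    - by apply: E_eq0; rewrite r0.
    - exact: (Lx X1).
    - exact: (Lx X2).
    - exact: (Lx X3).
  rewrite /F /phi /m /rho /y /= !subrr expr0n !addr0 subr0.
  have h : 0 < s ^+ 2 - K * r.
    rewrite /K subr_gt0 expr2 -!mulrA [s * r]mulrC !mulrA ltr_pM2r//.
    by rewrite (le_lt_trans _ sT)// ler_pM2l// mulr_gt0.
  rewrite max_l ?ltW// => /eqP; rewrite mulf_eq0 expf_eq0/= gt_eqF//= => /eqP e0.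
  have e1 : ut (x0, r) ^+ 2 / c x0 ^+ 2 = 0.
    have := sqr_ge0 (ux X1 (x0, r)); have := sqr_ge0 (ux X2 (x0, r)).
    have := sqr_ge0 (ux X3 (x0, r)).
    have : 0 <= ut (x0, r) ^+ 2 / c x0 ^+ 2 by rewrite divr_ge0 ?sqr_ge0.
    by move: e0; rewrite /e /=; lra.
  move/eqP: e1; rewrite mulf_eq0 expf_eq0/= invr_eq0 expf_eq0/= (negPf (c_neq0 x0)) orbF.
  by move/eqP.
have u0 : u (x0, 0) = 0.
  have r0 : rho x0 < s ^+ 2 by rewrite /rho /y !subrr !expr0n !addr0 exprn_gt0.
  by rewrite (jet_u0 J); exact: (nbhs_singleton (f0 r0)).
have [->//|tpos] := eqVneq t 0.
have {}tpos : 0 < t by rewrite lt_neqAle eq_sym tpos.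
have [||r + H] := @MVT _ (fun r => u (x0, r)) (fun r => ut (x0, r)) 0 t tpos.
- by move=> r; rewrite in_itv/= => /andP[r0 _]; exact: jet_u_t J _ _ r0.
- by apply: continuous_subspaceT; apply: continuous_time; exact: jet_u J.
rewrite in_itv/= => /andP[r0 rt]; move: H; rewrite u0 ut0 ?mul0r ?subr0//.
by rewrite !ltW// (lt_le_trans rt).
Qed.

End Cone.
End Propagation.

(** * Duality of two solutions *)

Section Duality.
Context {R : realType}.
Notation R3 := (R3 R).

Lemma is_derive_eq_cst (F G dF : R -> R) (T : R) : 0 < T ->
  continuous F -> continuous G ->
  (forall t, 0 < t < T -> is_derive t (1 : R) F (dF t)) ->
  (forall t, 0 < t < T -> is_derive t (1 : R) G (dF t)) ->
  F 0 = G 0 -> F T = G T.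
Proof.
move=> T0 cF cG dF1 dG FG0.
have H t : t \in `]0, T[ -> is_derive t (1 : R) (fun t => F t - G t) (dF t - dF t).
  by rewrite in_itv/= => tT; exact: (der_add (dF1 t tT) (der_opp (dG t tT))).
have [|t _] := @MVT _ _ (fun t => dF t - dF t) 0 T T0 H.
  by apply: continuous_subspaceT; cont.
by rewrite subrr mul0r FG0 !subrr subr0 => /eqP; rewrite subr_eq0 => /eqP.
Qed.

Section Pairing.
Variables (c f g : R3 -> R).
Variables (u ut utt : R3 * R -> R) (ux utx uxx : axis -> R3 * R -> R).
Variables (v vt vtt : R3 * R -> R) (vx vtx vxx : axis -> R3 * R -> R).
Variables (T L K : R).
Hypotheses (Ju : wave_jet c f u ut utt ux utx uxx)
  (Jv : wave_jet c g v vt vtt vx vtx vxx)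
  (cc : continuous c) (c_neq0 : forall x, c x != 0) (T0 : 0 < T)
  (L0 : 0 < L) (LK : L < K)
  (v_out : forall x t, 0 <= t <= T -> ~ box L x -> v (x, t) = 0).

Let ic (x : R3) : R := (c x ^+ 2)^-1.

Let cic : continuous ic.
Proof. by apply: cont_inv => [x|]; [rewrite expf_neq0|cont]. Qed.

Let cu := jet_u Ju.
Let cv := jet_u Jv.
Let cut := jet_ut Ju.
Let cvt := jet_ut Jv.
Let cutt := jet_utt Ju.
Let cvtt := jet_utt Jv.

Let near_out x : ~ (forall j, `|coord j x| < K) -> \forall y \near x, ~ box L y.
Proof.
move=> out.
have [j Kj] : exists j, K <= `|coord j x|.
  apply: contrapT => /forallNP H; apply: out => j.
  by rewrite ltNge; apply/negP; exact: H.
have cj : continuous (fun y : R3 => `|coord j y|).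
  apply: (@cont_comp _ _ _ (coord j) Num.norm); first exact: norm_continuous.
  by case: (j); rewrite /coord; cont.
have : \forall y \near x, L < `|coord j y|.
  by apply: (cvgr_gt _ (cj x)); exact: lt_le_trans Kj.
apply: filterS => y Lj /boxE[b1 b2 b3]; move: Lj; rewrite ltNge.
by case: (j); rewrite /= ?b1 ?b2 ?b3.
Qed.

Let v_out' x t : 0 <= t <= T -> ~ (forall j, `|coord j x| < K) -> v (x, t) = 0.
Proof.
by move=> tT /near_out/nbhs_singleton out; exact: v_out.
Qed.

Let vx_out i x t : 0 < t <= T -> ~ (forall j, `|coord j x| < K) -> vx i (x, t) = 0.
Proof.
move=> /andP[t0 tT] /near_out out.
have [_ <-] := jet_u_x Jv i x t0.
have E : \forall y \near x, (fun y => v (y, t)) y = cst 0 y.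
  by apply: filterS out => y out; apply: v_out => //; rewrite (ltW t0).
by rewrite (near_eq_derive _ E) derive_cst.
Qed.

Section Wronskian.
Variable s : R.
Hypothesis sT : 0 < s <= T.

Let W (z : R3 * R) : R :=
  ic z.1 * (ut z * v (z.1, s - z.2) + u z * vt (z.1, s - z.2)).
Let W_t (z : R3 * R) : R :=
  ic z.1 * (utt z * v (z.1, s - z.2) - u z * vtt (z.1, s - z.2)).

Let dW (x : R3) (t : R) : 0 < t < s ->
  is_derive t (1 : R) (fun r => W (x, r)) (W_t (x, t)).
Proof.
move=> /andP[t0 ts]; have st0 : 0 < s - t by rewrite subr_gt0.
have dst : is_derive t (1 : R) (fun t => s - t) (0 - 1).
  exact: (der_add (der_cst t (1 : R) s) (der_opp (der_id t))).
have dv : is_derive t (1 : R) (fun r => v (x, s - r)) (vt (x, s - t) * (0 - 1)).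
  by apply: (der_comp (f := fun r => v (x, r))) => //; exact: jet_u_t Jv _ _ st0.
have dvt : is_derive t (1 : R) (fun r => vt (x, s - r)) (vtt (x, s - t) * (0 - 1)).
  by apply: (der_comp (f := fun r => vt (x, r))) => //; exact: jet_ut_t Jv _ _ st0.
have H := der_mul (der_cst t (1 : R) (ic x)) (der_add
  (der_mul (jet_ut_t Ju x t0) dv) (der_mul (jet_u_t Ju x t0) dvt)).
by apply: (is_derive_eq H); rewrite /W_t /=; ring.
Qed.

Let W_t_int (t : R) : 0 < t < s -> boxint K (fun x => W_t (x, t)) = 0.
Proof.
move=> /andP[t0 ts]; have st0 : 0 < s - t by rewrite subr_gt0.
have stT : s - t <= T by case/andP: sT; lra.
pose H i (x : R3) := ux i (x, t) * v (x, s - t) - u (x, t) * vx i (x, s - t).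
pose H' i (x : R3) := uxx i (x, t) * v (x, s - t) - u (x, t) * vxx i (x, s - t).
have cH' i : continuous (H' i).
  by rewrite /H'; have h1 := jet_uxx Ju; have h2 := jet_uxx Jv; cont.
have H0 i : boxint K (H' i) = 0.
  apply: (@boxint_dir_eq0 _ K i (H i)) => //; first exact: lt_trans LK.
    move=> x; have D := der_add (der_mul (jet_ux_x Ju i x t0) (jet_u_x Jv i x st0))
      (der_opp (der_mul (jet_u_x Ju i x t0) (jet_ux_x Jv i x st0))).
    by apply: (is_derive_eq D); rewrite /H'; ring.
  by move=> x out; rewrite /H v_out' ?vx_out ?st0 ?stT ?ltW// !mulr0 subr0.
rewrite (@eq_boxint _ K _ (fun x => H' X1 x + H' X2 x + H' X3 x)); last first.
  move=> x _; rewrite /W_t /H' /ic /= (jet_wave Ju x t0) (jet_wave Jv x st0).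
  by field; exact: c_neq0.
rewrite (boxintD _ (cont_add (cH' X1) (cH' X2)) (cH' X3)) (boxintD _ (cH' X1) (cH' X2)).
by rewrite !H0 !addr0.
Qed.

(** The Wronskian of u(t) and v(s - t) for the weight c^-2 is conserved, since
c^2 Delta is symmetric for that weight. *)
Lemma wronskian_conserved : boxint K (fun x => ic x * (f x * vt (x, s))) =
  boxint K (fun x => ic x * (ut (x, s) * g x)).
Proof.
have s0 : 0 < s by case/andP: sT.
have c1 : continuous (fun z : R3 * R => ic z.1).
  exact: (@cont_comp _ _ _ (fun z : R3 * R => z.1) _ cic (cont_fst (@cont_id _))).
have cW : continuous W by rewrite /W; have h1 := cut; have h2 := cv; have h3 := cu; have h4 := cvt; cont.
have cW_t : continuous W_t.
  by rewrite /W_t; have h1 := cutt; have h2 := cv; have h3 := cu; have h4 := cvtt; cont.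
transitivity (boxint K (fun x => W (x, 0))).
  apply: eq_boxint => x _; rewrite /W /= subr0 (jet_ut0 Ju) (jet_u0 Ju).
  by rewrite mul0r add0r.
transitivity (boxint K (fun x => W (x, s))); last first.
  apply: eq_boxint => x _; rewrite /W /= subrr (jet_ut0 Jv) (jet_u0 Jv).
  by rewrite mulr0 addr0.
apply/esym; apply: (@is_derive_eq_cst (fun t => boxint K (fun x => W (x, t)))
  (fun _ => boxint K (fun x => W (x, 0))) (fun _ => 0) s) => //.
- exact: continuous_boxint.
- exact: cont_cst.
- move=> t ts; rewrite -(W_t_int ts).
  by apply: (is_derive_boxint (u := 0) (v := s)) => // x r _; exact: dW.
Qed.

End Wronskian.

(** Both pairings have the same derivative in time, by conservation of the
Wronskian, and the same value at time zero. *)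
Lemma wave_pairing : boxint K (fun x => u (x, T) * g x / c x ^+ 2) =
  boxint K (fun x => f x * v (x, T) / c x ^+ 2).
Proof.
have cf : continuous f.
  rewrite (_ : f = fun x => u (x, 0)); first exact: continuous_slice.
  by apply/funext => x; rewrite (jet_u0 Ju).
have cg : continuous g.
  rewrite (_ : g = fun x => v (x, 0)); first exact: continuous_slice.
  by apply/funext => x; rewrite (jet_u0 Jv).
have c1 : continuous (fun z : R3 * R => ic z.1).
  exact: (@cont_comp _ _ _ (fun z : R3 * R => z.1) _ cic (cont_fst (@cont_id _))).
have hu := cu; have hut := cut; have hv := cv; have hvt := cvt.
pose A (z : R3 * R) : R := ic z.1 * (u z * g z.1).
pose A_t (z : R3 * R) : R := ic z.1 * (ut z * g z.1).
pose B (z : R3 * R) : R := ic z.1 * (f z.1 * v z).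
pose B_t (z : R3 * R) : R := ic z.1 * (f z.1 * vt z).
have cA : continuous A by rewrite /A; cont.
have cA_t : continuous A_t by rewrite /A_t; cont.
have cB : continuous B by rewrite /B; cont.
have cB_t : continuous B_t by rewrite /B_t; cont.
transitivity (boxint K (fun x => A (x, T))).
  by apply: eq_boxint => x _; rewrite /A /ic /= mulrC.
transitivity (boxint K (fun x => B (x, T))); last first.
  by apply: eq_boxint => x _; rewrite /B /ic /= mulrC.
apply: (@is_derive_eq_cst (fun t => boxint K (fun x => A (x, t)))
  (fun t => boxint K (fun x => B (x, t))) (fun t => boxint K (fun x => A_t (x, t))) T) => //.
- exact: continuous_boxint.
- exact: continuous_boxint.
- move=> t tT; apply: (is_derive_boxint (u := 0) (v := T)) => // x r _ /andP[r0 _].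
  apply: (is_derive_eq (der_mul (der_cst r (1 : R) (ic x)) (der_mul (jet_u_t Ju x r0)
    (der_cst r (1 : R) (g x))))).
  by rewrite /A_t /=; ring.
- move=> t /andP[t0 tT].
  rewrite (_ : boxint K _ = boxint K (fun x => B_t (x, t))); last first.
    by apply/esym/wronskian_conserved; rewrite t0 ltW.
  apply: (is_derive_boxint (u := 0) (v := T)) => //; first by rewrite t0.
  move=> x r _ /andP[r0 _].
  apply: (is_derive_eq (der_mul (der_cst r (1 : R) (ic x)) (der_mul
    (der_cst r (1 : R) (f x)) (jet_u_t Jv x r0)))).
  by rewrite /B_t /=; ring.
- by apply: eq_boxint => x _; rewrite /A /B /= (jet_u0 Ju) (jet_u0 Jv).
Qed.

End Pairing.
End Duality.

(** * Smooth approximations of octants in a ball *)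

Section SmoothFunctions.
Context {R : realType} {V : normedModType R}.
Implicit Types u w : V -> R.

(** Unlike iter_derive, this peels off the first derivative taken, which is
what the product and chain rules are compatible with. *)
Fixpoint Cn (k : nat) (u : V -> R) : Prop :=
  continuous u /\
  if k is k'.+1 then forall v, (forall x, derivable u x v) /\ Cn k' ('D_v u)
  else True.

Lemma Cn_cont k u : Cn k u -> continuous u.
Proof. by case: k => [|k] []. Qed.

Lemma CnS k u : Cn k.+1 u -> Cn k u.
Proof.
elim: k u => [|k IH] u [cu Du]; first by [].
by split=> // v; have [d1 d2] := Du v; split=> //; exact: IH.
Qed.

Lemma CnS_intro k u (u' : V -> V -> R) : continuous u ->
  (forall v x, is_derive x v u (u' v x)) -> (forall v, Cn k (u' v)) -> Cn k.+1 u.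
Proof.
move=> cu du Cu'; split=> // v; split=> [x|]; first by case: (du v x).
by rewrite (_ : 'D_v u = u' v)//; apply/funext => x; case: (du v x).
Qed.

Lemma Cn_derive k u v x : Cn k.+1 u -> is_derive x v u ('D_v u x).
Proof. by case=> _ /(_ v)[d _]; exact: derivableP. Qed.

Lemma Cn_deriveS k u v : Cn k.+1 u -> Cn k ('D_v u).
Proof. by case=> _ /(_ v)[d1 d2]; exact: d2. Qed.

Lemma Cn_cst k (a : R) : Cn k (fun _ : V => a).
Proof.
elim: k a => [|k IH] a; first by split=> //; exact: cont_cst.
exact: (CnS_intro (@cont_cst _ _ a) (fun v x => der_cst x v a) (fun _ => IH 0)).
Qed.

Lemma CnD k u w : Cn k u -> Cn k w -> Cn k (fun x => u x + w x).
Proof.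
elim: k u w => [|k IH] u w Cu Cw.
  by split=> //; apply: cont_add; [case: Cu|case: Cw].
apply: (CnS_intro (u' := fun v x => 'D_v u x + 'D_v w x)).
- by apply: cont_add; [exact: Cn_cont Cu|exact: Cn_cont Cw].
- by move=> v x; exact: (der_add (Cn_derive v x Cu) (Cn_derive v x Cw)).
- by move=> v; apply: IH; exact: Cn_deriveS.
Qed.

Lemma CnM k u w : Cn k u -> Cn k w -> Cn k (fun x => u x * w x).
Proof.
elim: k u w => [|k IH] u w Cu Cw.
  by split=> //; apply: cont_mul; [case: Cu|case: Cw].
apply: (CnS_intro (u' := fun v x => 'D_v u x * w x + u x * 'D_v w x)).
- by apply: cont_mul; [exact: Cn_cont Cu|exact: Cn_cont Cw].
- by move=> v x; exact: (der_mul (Cn_derive v x Cu) (Cn_derive v x Cw)).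
- by move=> v; apply: CnD; apply: IH; [exact: Cn_deriveS|exact: CnS|exact: CnS|exact: Cn_deriveS].
Qed.

(** Continuous linear forms have constant directional derivatives. *)
Lemma Cn_additive k (l : V -> R) : continuous l ->
  (forall (h : R) v x, l (h *: v + x) = h * l v + l x) -> Cn k l.
Proof.
move=> cl lE; case: k => [|k]; first by [].
apply: (CnS_intro (u' := fun v _ => l v)) => //; last by move=> v; exact: Cn_cst.
move=> v x; apply/der_line.
have := der_add (der_mul (der_id (0 : R)) (der_cst (0 : R) (1 : R) (l v))) (der_cst (0 : R) (1 : R) (l x)).
rewrite mul1r mulr0 !addr0.
by rewrite (_ : (fun _ => _) = (fun h : R => l (h *: v + x)))//; apply/funext => h; rewrite lE.
Qed.

Lemma Cn_iter_derive s k u : Cn (size s + k) u -> Cn k (iter_derive s u).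
Proof.
elim: s k => [|v s IH] k //= Cu; apply: Cn_deriveS; apply: IH.
by rewrite addnS.
Qed.

Lemma Cn_smooth u : (forall k, Cn k u) -> smooth u.
Proof.
move=> Cu k s _; split=> [x v _ _|x _].
  have : Cn 1 (iter_derive s u) by exact: Cn_iter_derive.
  by case=> _ /(_ v)[].
exists (iter_derive s u x); apply: cvg_within_filter.
by have /Cn_cont := Cn_iter_derive (Cu (size s + 0)%N); exact.
Qed.

End SmoothFunctions.

Section FlatFunctions.
Context {R : realType}.

(** The derivatives of exp(-1/x) for x > 0 are combinations of the
x^(-m) exp(-1/x). *)
Definition flat (m : nat) (x : R) : R :=
  if 0 < x then x^-1 ^+ m * expR (- x^-1) else 0.

(** From exp y >= y^(m+2) / (m+2)! at y = 1/x; the square makes flat m differentiable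
at 0. *)
Lemma flat_le (m : nat) (x : R) : 0 <= flat m x <= (m.+2)`!%:R * `|x| ^+ 2.
Proof.
rewrite /flat; case: ifPn => [x0|_]; last first.
  by rewrite lexx mulr_ge0// exprn_ge0.
have y0 : 0 < x^-1 by rewrite invr_gt0.
rewrite mulr_ge0 ?expR_ge0 ?exprn_ge0 ?(ltW y0)//= gtr0_norm// expRN.
rewrite ler_pdivrMr ?expR_gt0//.
have fpos : 0 < (m.+2)`!%:R :> R by rewrite ltr0n fact_gt0.
have h : x^-1 ^+ m.+2 <= (m.+2)`!%:R * expR x^-1.
  rewrite mulrC -ler_pdivrMr//; apply: le_trans (expR_ge1Dxn m.+1 (ltW y0)).
  by rewrite lerDr.
have -> : x^-1 ^+ m = x ^+ 2 * x^-1 ^+ m.+2.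
  by rewrite -[m.+2]addn2 exprD mulrCA -exprMn divff ?gt_eqF// expr1n mulr1.
by rewrite [_ * x ^+ 2]mulrC -[leRHS]mulrA ler_pM2l ?exprn_gt0.
Qed.

Lemma der_flat (m : nat) (x : R) :
  is_derive x (1 : R) (flat m) (- m%:R * flat m.+1 x + flat m.+2 x).
Proof.
have [x0|x0|->] := ltgtP x 0.
- rewrite /flat !ifN -?leNgt ?(ltW x0)// mulr0 addr0.
  apply: (near_eq_is_derive (f := cst 0)).
  by near=> y; rewrite ifN// -leNgt ltW//; near: y; exact: lt_nbhsl.
- have dinv : is_derive x (1 : R) (fun y => y^-1) (- (x^-1 ^+ 2)).
    have H := @is_deriveV _ id x 1 1.
    apply: is_derive_eq; first by apply: H; rewrite gt_eqF.
    by rewrite /GRing.scale/= mulr1 exprVn.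
  have dpow : is_derive x (1 : R) (fun y => y^-1 ^+ m * expR (- y^-1))
      (- m%:R * (x^-1 ^+ m.+1 * expR (- x^-1)) + x^-1 ^+ m.+2 * expR (- x^-1)).
    elim: m => [|m IH].
      have dexp : is_derive x (1 : R) (fun y => expR (- y^-1)) (expR (- x^-1) * x^-1 ^+ 2).
        have dN := der_opp dinv; rewrite opprK in dN.
        exact: (der_comp (g := fun y => - y^-1) (is_derive_expR (- x^-1)) dN).
      have := der_mul (der_cst x (1 : R) 1) dexp.
      rewrite (_ : (fun _ => _) = (fun y => y^-1 ^+ 0 * expR (- y^-1)))//.
      by rewrite mul0r add0r mul1r oppr0 mul0r add0r mulrC.
    have := der_mul dinv IH.
    rewrite (_ : (fun _ => _) = (fun y => y^-1 ^+ m.+1 * expR (- y^-1))); last first.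
      by apply/funext => y; rewrite exprS mulrA.
    move=> H; apply: (is_derive_eq H).
    by set w := x^-1; set E := expR _; rewrite -[in RHS]natr1 !exprS; ring.
  have fE n y : 0 < y -> y^-1 ^+ n * expR (- y^-1) = flat n y.
    by rewrite /flat => ->.
  have E : \forall y \near x, (fun y => y^-1 ^+ m * expR (- y^-1)) y = flat m y.
    by near=> y; apply: fE; near: y; exact: lt_nbhsr.
  by rewrite -!fE//; exact: (near_eq_is_derive E dpow).
- have z n : flat n 0 = 0 by rewrite /flat ltxx.
  rewrite !z mulr0 addr0.
  have H : h^-1 *: (flat m (h *: (1 : R) + 0) - flat m 0) @[h --> (0:R)^'] --> (0 : R).
    pose C : R := (m.+2)`!%:R.
    have C0 : 0 < C by rewrite ltr0n fact_gt0.
    apply/cvgrPdist_le => e e0; near=> h.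
    rewrite z subr0 addr0 -[h *: (1 : R)]/(h * 1) mulr1 sub0r normrN -[_ *: _]/(_ * _).
    rewrite normrM normfV.
    have h0 : h != 0 by near: h; exact: nbhs_dnbhs_neq.
    have hp : 0 < `|h| by rewrite normr_gt0.
    rewrite ler_pdivrMl//.
    have he : `|h| <= e / C by near: h; apply: dnbhs0_le; rewrite divr_gt0.
    have /andP[f0 f1] := flat_le m h.
    rewrite ger0_norm// (le_trans f1)// -/C expr2 mulrCA ler_wpM2l//.
    by rewrite -ler_pdivlMl// mulrC.
  by split; [apply/cvg_ex; exists 0|apply: cvg_lim].
Unshelve. all: by end_near. Qed.

Lemma flat_continuous m : continuous (flat m).
Proof.
move=> x; apply/differentiable_continuous/derivable1_diffP.
by have [] := der_flat m x.
Qed.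

(** The derivatives of flat m (u x) stay in the span of the flat m' (u x) multiplied
by derivatives of u, so one induction on k handles all m at once. *)
Lemma Cn_flat {V : normedModType R} k m (u : V -> R) : Cn k u ->
  Cn k (fun x => flat m (u x)).
Proof.
elim: k m u => [|k IH] m u Cu.
  by split=> //; apply: cont_comp; [exact: flat_continuous|case: Cu].
apply: (CnS_intro (u' := fun v x =>
  (- m%:R * flat m.+1 (u x) + flat m.+2 (u x)) * 'D_v u x)).
- by apply: cont_comp; [exact: flat_continuous|exact: Cn_cont Cu].
- move=> v x; apply: (der_scalar_comp (h := flat m)); first exact: der_flat.
  exact: (Cn_derive v x Cu).
- move=> v; apply: CnM; last exact: Cn_deriveS.
  apply: CnD; last exact/IH/CnS.
  by apply: CnM; [exact: Cn_cst|exact/IH/CnS].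
Qed.

(** As n grows, exp(-1/((n+1) x)) tends to 1 for x > 0. *)
Definition step (n : nat) (x : R) : R := flat 0 (n.+1%:R * x).

Lemma step_ge0 n x : 0 <= step n x.
Proof. by have /andP[] := flat_le 0 (n.+1%:R * x). Qed.

Lemma step_le1 n x : step n x <= 1.
Proof.
rewrite /step /flat; case: ifP => // x0; rewrite expr0 mul1r expR_le1.
by rewrite oppr_le0 invr_ge0 ltW.
Qed.

Lemma step_neq0 n x : (step n x != 0) = (0 < x).
Proof.
rewrite /step /flat; case: ifPn; rewrite pmulr_rgt0// => x0.
  by rewrite expr0 mul1r expR_eq0.
by rewrite eqxx (negPf x0).
Qed.

Lemma step_cvg x : step n x @[n --> \oo] --> ((0 < x)%R%:R : R).
Proof.
case: ltP => x0; last first.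
  rewrite (_ : (fun n => step n x) = cst 0); first exact: cvg_cst.
  apply/funext => n; apply/eqP; rewrite -[_ == _]negbK step_neq0.
  by rewrite -leNgt.
rewrite (_ : (fun n => step n x) = (fun n => expR (- (harmonic n * x^-1)))); last first.
  apply/funext => n; rewrite /step /flat pmulr_rgt0// x0 expr0 mul1r invfM.
  by [].
rewrite -[X in _ --> X]expR0 -oppr0 -(mul0r x^-1).
apply: continuous_cvg; first exact: continuous_expR.
apply: cvgN; apply: cvgM; [exact: cvg_harmonic|exact: cvg_cst].
Qed.

End FlatFunctions.

Section BumpFunction.
Context {R : realType}.
Notation R3 := (R3 R).
Variables (a b : R) (al : axis -> R).
Hypotheses (b0 : 0 < b) (ba : b < a).

Definition gap (x : R3) : R :=
  b ^+ 2 - (coord X1 x ^+ 2 + coord X2 x ^+ 2 + coord X3 x ^+ 2).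

(** The first factor cuts off outside the ball of radius b, the others outside an
octant with apex al. *)
Definition bump (n : nat) (x : R3) : R :=
  step n (gap x) * (step n (coord X1 x - al X1) * step n (coord X2 x - al X2) *
    step n (coord X3 x - al X3)).

Lemma coord_continuous i : continuous (@coord R i).
Proof. by case: i; rewrite /coord; cont. Qed.

Lemma Cn_coord k i : Cn k (@coord R i).
Proof.
by apply: Cn_additive => [|h v x]; [exact: coord_continuous|case: i].
Qed.

Lemma Cn_bump k n : Cn k (bump n).
Proof.
have st (u : R3 -> R) : Cn k u -> Cn k (fun x => step n (u x)).
  by move=> Cu; apply: Cn_flat; apply: CnM => //; exact: Cn_cst.
have sc i : Cn k (fun x => step n (coord i x - al i)).
  by apply: st; apply: CnD; [exact: Cn_coord|exact: Cn_cst].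
have sq i : Cn k (fun x : R3 => coord i x ^+ 2) by apply: CnM; exact: Cn_coord.
apply: CnM; last by apply: CnM; [apply: CnM|]; exact: sc.
apply: st; apply: CnD; first exact: Cn_cst.
rewrite (_ : (fun _ => _) = (fun x : R3 => -1 * (coord X1 x ^+ 2 + coord X2 x ^+ 2 + coord X3 x ^+ 2))); last first.
  by apply/funext => x; rewrite mulN1r.
apply: CnM; first exact: Cn_cst.
by apply: CnD => //; apply: CnD.
Qed.

Lemma bump_continuous n : continuous (bump n).
Proof. exact: Cn_cont (Cn_bump 0 n). Qed.

Lemma bump_smooth n : smooth (bump n).
Proof. by apply: Cn_smooth => k; exact: Cn_bump. Qed.

Lemma gap_continuous : continuous gap.
Proof. by rewrite /gap; have h := coord_continuous; cont. Qed.

Lemma gap_gt0 x : 0 < gap x -> forall i, `|coord i x| < b.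
Proof.
rewrite /gap subr_gt0 => gx i.
rewrite -(@ltr_pXn2r _ 2) ?nnegrE ?normr_ge0 ?(ltW b0)//.
rewrite real_normK ?num_real// (le_lt_trans _ gx)//.
have := sqr_ge0 (coord X1 x); have := sqr_ge0 (coord X2 x).
by have := sqr_ge0 (coord X3 x); case: i; lra.
Qed.

Lemma bump_norm_le1 n x : `|bump n x| <= 1.
Proof.
rewrite ger0_norm ?mulr_ge0 ?step_ge0//.
by do 3 ?[rewrite mulr_ile1 ?mulr_ge0 ?step_ge0 ?step_le1//].
Qed.

Lemma bump_cvg x : bump n x @[n --> \oo] -->
  (((0 < gap x) && [&& al X1 < coord X1 x, al X2 < coord X2 x & al X3 < coord X3 x])%R%:R : R).
Proof.
have -> : ((0 < gap x) && [&& al X1 < coord X1 x, al X2 < coord X2 x & al X3 < coord X3 x])%R%:R =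
  (0 < gap x)%R%:R * ((0 < coord X1 x - al X1)%R%:R * (0 < coord X2 x - al X2)%R%:R *
    (0 < coord X3 x - al X3)%R%:R) :> R.
  rewrite !subr_gt0 -!natrM !mulnb.
  by rewrite -!andbA.
by apply: cvgM; [|apply: cvgM; [apply: cvgM|]]; exact: step_cvg.
Qed.

Lemma closure_bump n : closure [set x | bump n x != 0] `<=` [set x | 0 <= gap x].
Proof.
apply: (@subset_trans _ (closure [set x | 0 <= gap x])).
  apply: closureS => x /=; rewrite /bump mulf_eq0 negb_or step_neq0.
  by move=> /andP[/ltW].
have -> : closure [set x | 0 <= gap x] = [set x | 0 <= gap x] => //.
apply/esym/closure_id; apply: (@closed_comp _ _ gap [set y | 0 <= y]).
  by move=> x _; exact: gap_continuous.
exact: closed_ge.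
Qed.

Lemma bump_Cc n : Cc_infty (ball3 a) (bump n).
Proof.
split; first exact: bump_smooth.
- apply: (@subclosed_compact _ _ (box b)).
  + exact: closed_closure.
  + exact: compact_box.
  + move=> x /closure_bump; rewrite /= /gap subr_ge0 => qx; apply/boxE.
    have le_b i : `|coord i x| <= b.
      rewrite -(@ler_pXn2r _ 2) ?nnegrE ?normr_ge0 ?(ltW b0)//.
      rewrite real_normK ?num_real// (le_trans _ qx)//.
      have := sqr_ge0 (coord X1 x); have := sqr_ge0 (coord X2 x).
      by have := sqr_ge0 (coord X3 x); case: i; lra.
    by split; [exact: (le_b X1)|exact: (le_b X2)|exact: (le_b X3)].
- move=> x /closure_bump; rewrite /= /gap subr_ge0 /ball3 /norm3 /= => qx.
  rewrite (le_lt_trans _ ba)//.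
  rewrite -(ger0_norm (ltW b0)) -sqrtr_sqr; exact: ler_wsqrtr.
Qed.

End BumpFunction.

(** * Functions orthogonal to all bump functions *)

Section Density.
Context {R : realType}.
Notation R3 := (R3 R).
Notation M3 := (M3 R).

Definition octant (al : axis -> R) : set M3 := [set x | forall i, al i < coord i x].

Definition octants : set (set M3) := range octant.

Lemma octantE al : octant al =
  `]al X1, +oo[%classic `*` `]al X2, +oo[%classic `*` `]al X3, +oo[%classic.
Proof.
apply/seteqP; split => [x H|x [[]]] /=.
  by rewrite !in_itv/= !andbT; split; [split; [exact: (H X1)|exact: (H X2)]|exact: (H X3)].
by rewrite !in_itv/= !andbT => h1 h2 h3; case.
Qed.

Lemma measurable_octant al : measurable (octant al).
Proof.
by rewrite octantE; apply: measurableX; [apply: measurableX|]; exact: measurable_itv.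
Qed.

Lemma octants_setI : setI_closed octants.
Proof.
move=> _ _ [al _ <-] [be _ <-]; exists (fun i => Num.max (al i) (be i)) => //.
apply/seteqP; split => x /= H.
  by split => i; have := H i; rewrite gt_max => /andP[].
by move=> i; rewrite gt_max H.1 H.2.
Qed.

Let S : measurableType _ := g_sigma_algebraType octants.

(** Half-spaces are countable unions of octants. *)
Let measurable_coord i : measurable_fun [set: S] (coord i : S -> measurableTypeR R).
Proof.
apply: (measurability _ (RGenOInfty.measurableE R)) => _ [_ [a ->] <-].
rewrite setTI.
have -> : coord i @^-1` `]a, +oo[ = \bigcup_k octant (fun j =>
    match i, j with X1, X1 | X2, X2 | X3, X3 => a | _, _ => - k%:R end).
  apply/seteqP; split => [x|x [k _ /(_ i)]]; rewrite /= in_itv/= andbT.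
    move=> ax; pose r := `|coord X1 x| + `|coord X2 x| + `|coord X3 x|.
    have kr j : - (Num.truncn r).+1%:R < coord j x.
      have rk := truncnS_gt r.
      have := normr_ge0 (coord X1 x); have := normr_ge0 (coord X2 x).
      have := normr_ge0 (coord X3 x); have : - `|coord j x| <= coord j x by rewrite lerNl -normrN ler_norm.
      by move: rk; rewrite /r; case: j; lra.
    exists (Num.truncn r).+1 => // j.
    by case: i ax; case: j => // ax; exact: kr.
  by case: i.
by apply: bigcup_measurable => k _; apply: sub_sigma_algebra; eexists.
Qed.

Lemma measurable_octants : @measurable _ M3 = <<s octants >>.
Proof.
apply/seteqP; split; last first.
  apply: smallest_sub; first exact: sigma_algebra_measurable.
  by move=> _ [al _ <-]; exact: measurable_octant.
have mid : measurable_fun [set: S] (fun x : S => (coord X1 x, coord X2 x, coord X3 x) : M3).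
  by apply: measurable_fun_pair; [apply: measurable_fun_pair|]; exact: measurable_coord.
move=> E mE; have := mid measurableT E mE; rewrite setTI.
by rewrite (_ : _ @^-1` E = E)//; apply/seteqP; split => -[[]].
Qed.

Section NullOfOctants.
Variables (mu : {measure set M3 -> \bar R}) (w : M3 -> \bar R).
Hypotheses (iw : mu.-integrable setT w) (b : R)
  (w_out : forall x, w x != 0%E -> octant (fun=> b) x)
  (w0 : forall al, (\int[mu]_(x in octant al) w x = 0)%E).

(** Sets over which the integral vanishes form a Dynkin system. *)
Lemma integral_octants_eq0 E : measurable E -> (\int[mu]_(x in E) w x = 0)%E.
Proof.
have wT : (\int[mu]_x w x = 0)%E.
  rewrite -(w0 (fun=> b)) [RHS]integral_mkcond; apply: eq_integral => x _.
  rewrite patchE; case: ifPn => // nx; apply/eqP.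
  by apply: contraNT nx => /w_out ?; apply/mem_set.
rewrite measurable_octants => mE.
apply: (dynkin_induction (P := fun E => (\int[mu]_(x in E) w x = 0)%E) measurable_octants octants_setI) mE => //.
- by move=> _ [al _ <-]; exact: w0.
- move=> D mD D0; have := wT; rewrite -(setUv D) integral_setU//.
  + by rewrite [X in (X + _)%E]D0 add0e.
  + exact: measurableC.
  + by rewrite setUv; exact: measurable_int iw.
  + by rewrite disj_set2E setICr.
- move=> F mF tF F0; rewrite integral_bigcup//.
    by apply: eseries0 => n _ _; exact: F0.
  by apply: integrableS iw => //; exact: bigcup_measurable.
Qed.

Lemma null_of_octants : ae_eq mu setT w (cst 0%E).
Proof.
apply: integral_ae_eq => // E _ mE.
by rewrite integral0 integral_octants_eq0.
Qed.
End NullOfOctants.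

Section NullOfTests.
Variables (mu : {measure set M3 -> \bar R}) (w : M3 -> R) (a : R).
Hypotheses (a0 : 0 < a) (iw : mu.-integrable setT (EFin \o w))
  (w0 : forall b al n, 0 < b -> b < a ->
     (\int[mu]_x (bump b al n x * w x)%:E = 0)%E).

Let inner (b : R) (x : M3) : \bar R := ((0 < gap b x)%R%:R * w x)%:E.

Let mw : measurable_fun setT w.
Proof. by apply/measurable_EFinP; exact: measurable_int iw. Qed.

Let measurable_inner b : measurable_fun setT (inner b).
Proof.
apply/measurable_EFinP/measurable_funM => //.
have -> : (fun x : M3 => (0 < gap b x)%R%:R : R) = \1_[set x | 0 < gap b x].
  by apply/funext => x; rewrite indicE /= mem_setE.
apply: measurable_indic; apply: open_measurable3.
apply: (@open_comp _ _ (gap b) [set t | 0 < t]); last exact: open_gt.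
by move=> x _; exact: gap_continuous.
Qed.

Let integrable_inner b : mu.-integrable setT (inner b).
Proof.
apply: (@le_integrable _ _ _ _ _ _ _ (EFin \o w)) => // x _.
rewrite /inner /= lee_fin normrM.
by case: (0 < gap b x); rewrite ?normr1 ?mul1r// normr0 mul0r.
Qed.

Let inner_octant b al : 0 < b -> b < a -> (\int[mu]_(x in octant al) inner b x = 0)%E.
Proof.
move=> b0 ba.
have lim : (\int[mu]_x (bump b al n x * w x)%:E)%E @[n --> \oo] -->
    (\int[mu]_x ((inner b \_ (octant al)) x))%E.
  apply: (@dominated_cvg _ _ _ mu setT measurableT _ _ (abse \o (EFin \o w))) => //.
  - move=> n; apply/measurable_EFinP/measurable_funM => //.
    by apply: continuous_measurable3; exact: bump_continuous.
  - move=> x _; rewrite (_ : (_ \_ _) x = ((((0 < gap b x) &&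
      [&& al X1 < coord X1 x, al X2 < coord X2 x & al X3 < coord X3 x])%R%:R : R) * w x)%:E).
      apply: cvg_EFin; first exact: nearW.
      by apply: cvgM; [exact: bump_cvg|exact: cvg_cst].
    rewrite patchE /inner; case: ifPn => [/set_mem H|nH].
      by rewrite (H X1) (H X2) (H X3) !andbT.
    rewrite [X in _ && X](_ : _ = false) ?andbF ?mul0r//.
    apply/negbTE; apply: contra nH => /and3P[h1 h2 h3]; apply/mem_set.
    by case.
  - exact: integrable_abse.
  - move=> n x _; rewrite /= lee_fin normrM ler_piMl//.
    exact: bump_norm_le1.
rewrite integral_mkcond -(cvg_lim _ lim)//.
by rewrite (_ : (fun n => _) = cst 0%E) ?lim_cst//; apply/funext => n; exact: w0.
Qed.

(** For fixed b < a, dominated convergence turns orthogonality to bumps into zero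
integrals over octants of the restriction of w to the ball of radius b. The balls
of radius a - a / (k + 2) exhaust the ball of radius a. *)
Lemma null_of_tests : {ae mu, forall x, ball3 a x -> w x = 0}.
Proof.
pose r (k : nat) := a - a / k.+2%:R.
have r0 k : 0 < r k.
  by rewrite /r subr_gt0 gtr_pMr// invf_lt1// ltr1n.
have ra k : r k < a by rewrite /r ltrBlDr ltrDl divr_gt0.
have H k : {ae mu, forall x, inner (r k) x = 0%E}.
  have := @null_of_octants mu (inner (r k)) (integrable_inner (r k)) (- r k) _ _.
  case=> [x| al|N hN].
  - rewrite /inner; case: (boolP (0 < gap (r k) x)); last by rewrite mul0r eqxx.
    by move=> /(gap_gt0 (r0 k)) gx _ i; have := gx i; rewrite ltr_norml => /andP[].
  - exact: inner_octant.
  - by exists N; case: hN => ? ? h; split=> // x /= nx; apply: h => /= /(_ I).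
have := ae_foralln H; apply: filterS => x Hx; rewrite /ball3 /norm3 /= => xa.
set t := Num.sqrt _ in xa.
have t0 : 0 <= t by exact: sqrtr_ge0.
have [k kt] : exists k, t < r k.
  exists (Num.truncn (a / (a - t))); rewrite /r ltrBrDr -ltrBrDl ltr_pdivrMr//.
  rewrite -ltr_pdivrMl ?subr_gt0// mulrC.
  by rewrite (lt_trans (truncnS_gt _))// ltr_nat.
have := Hx k; rewrite /inner; rewrite (_ : 0 < gap (r k) x); first by rewrite mul1r => -[].
rewrite /gap subr_gt0 -(@sqr_sqrtr _ (_ + _)); last by rewrite !addr_ge0 ?sqr_ge0.
by rewrite ltr_pXn2r// nnegrE ?ltW.
Qed.

End NullOfTests.
End Density.

(** * Integrals over the space, over boxes and over balls *)

Section Assembly.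
Context {R : realType}.
Notation R3 := (R3 R).
Notation M3 := (M3 R).

Lemma smooth_continuous (h : R3 -> R) : smooth h -> continuous h.
Proof.
move=> sh; have hl : has_limits setT h.
  by have [_ H] := sh 0%N [::] isT; exact: H.
have clT (z : R3) : closure setT z by exact: subset_closure.
have := @ext_continuous _ _ setT id (@cont_id _) clT _ hl.
rewrite (_ : ext _ _ h = h)//; apply/funext => z.
exact: (ext_in (fun _ _ => erefl) clT hl I).
Qed.

Lemma ball3_box (a : R) (x : R3) : ball3 a x -> box a x.
Proof.
rewrite /ball3 /norm3 /= => xa; apply/boxE.
have le t : t ^+ 2 <= x.1.1 ^+ 2 + x.1.2 ^+ 2 + x.2 ^+ 2 -> `|t| <= a.
  by move=> tx; rewrite (le_trans _ (ltW xa))// -sqrtr_sqr ler_wsqrtr.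
have := sqr_ge0 x.1.1; have := sqr_ge0 x.1.2; have := sqr_ge0 x.2 => h1 h2 h3.
by split; apply: le; lra.
Qed.

Lemma bounded_cst_out (K k : R) (h : R3 -> R) : continuous h ->
  (forall x, ~ box K x -> h x = k) -> exists M, forall x, `|h x| <= M.
Proof.
move=> ch hk.
have /compact_bounded[M [_ hM]] : compact (h @` box K).
  by apply: continuous_compact; [exact: continuous_subspaceT|exact: compact_box].
exists (Num.max (`|M| + 1) `|k|) => x; rewrite le_max.
have [Bx|/hk ->] := pselect (box K x); last by rewrite lexx orbT.
apply/orP; left; apply: (hM (`|M| + 1)); last by exists x.
by rewrite (le_lt_trans (ler_norm M))// ltrDl.
Qed.

Lemma integral_boxint (K : R) (h : R3 -> R) : (forall x, ~ box K x -> h x = 0) ->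
  \int[leb3]_x h x = boxint K h.
Proof.
move=> h0; rewrite /boxint [RHS]Rintegral_mkcond; congr Rintegral.
by apply/funext => x; rewrite patchE; case: ifPn => // /negP nx; apply: h0 => ?;
  apply: nx; apply/mem_set.
Qed.

Lemma integral_leb_ball (a K : R) (h : R3 -> R) : a <= K ->
  (forall x, ~ ball3 a x -> h x = 0) ->
  \int[leb_ball a]_x h x = boxint K h.
Proof.
move=> aK h0; rewrite -integral_boxint; last first.
  move=> x nx; apply: h0 => /ball3_box/boxE[b1 b2 b3]; apply: nx; apply/boxE.
  by split; exact: le_trans aK.
have hE : h = h \_ (ball3 a).
  by apply/funext => x; rewrite patchE; case: ifPn => // /negP nx; apply: h0 => ?;
    apply: nx; apply/mem_set.
transitivity (\int[leb_ball a]_(x in ball3 a) h x).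
  by rewrite [RHS]Rintegral_mkcond -hE.
transitivity (\int[leb3]_(x in ball3 a) h x); last first.
  by rewrite [LHS]Rintegral_mkcond -hE.
rewrite /Rintegral; apply: (congr1 fine).
apply: eq_measure_integral => B mB BA.
by transitivity (leb3 (B `&` ball3 a)); [|rewrite (setIidl BA)].
Qed.

Lemma leb_ball_fin (a : R) : (leb_ball a setT < +oo)%E.
Proof.
rewrite /leb_ball /= /mrestr setTI (le_lt_trans _ (leb3_box_lty a))//.
apply: le_measure; rewrite ?inE; [exact: measurable_ball3|exact: measurable_box|].
exact: ball3_box.
Qed.

Lemma ae_ball3 (a : R) : {ae leb_ball a, forall x, ball3 a x}.
Proof.
exists (~` ball3 a); split => //.
  by apply: measurableC; exact: measurable_ball3.
transitivity (leb3 (~` ball3 a `&` ball3 a : set M3)) => //.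
by rewrite setICl measure0.
Qed.

Lemma bump_Lfun (a b : R) al n : bump b al n \in Lfun (leb_ball a) (2%:R)%:E.
Proof.
have mt : measurable_fun setT (bump b al n : M3 -> R).
  by apply: continuous_measurable3; exact: bump_continuous.
rewrite inE; apply/andP; split; rewrite inE//=.
rewrite /finite_norm unlock /Lnorm /= poweR_lty//.
apply: (@le_lt_trans _ _ (\int[leb_ball a]_x (cst 1%E x))%E).
  apply: ge0_le_integral => //.
  - apply/measurable_EFinP; apply: (measurableT_comp (measurable_powR _)) => //.
    exact: measurableT_comp.
  - move=> x _; rewrite lee_fin; apply: (@le_trans _ _ (1 `^ 2)).
      by rewrite ge0_ler_powR ?nnegrE//; exact: bump_norm_le1.
    by rewrite powR1.
by rewrite integral_cst//= mul1e leb_ball_fin.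
Qed.

End Assembly.

(** * The adjoint of the solution operator *)

Section Final.
Context {R : realType}.
Notation R3 := (R3 R).
Notation M3 := (M3 R).

Lemma Cc_support (U : set R3) (g : R3 -> R) : Cc_infty U g ->
  exists2 L, 0 < L & forall x, ~ box L x -> g x = 0.
Proof.
case=> _ /compact_bounded[M [_ hM]] _; exists (`|M| + 2); first by rewrite ltr_wpDl.
move=> x nB; apply: contrapT => /eqP gx; apply: nB; apply/boxE.
have : `|x| <= `|M| + 1.
  apply: hM; first by rewrite (le_lt_trans (ler_norm M))// ltrDl.
  exact: subset_closure.
move=> xM; have : ball (0 : R3) (`|M| + 2) x.
  rewrite -ball_normE /= sub0r normrN (le_lt_trans xM)// ltrD2l ltr1n//.
by move=> [[]]; rewrite /ball /= !sub0r !normrN => /ltW ? /ltW ? /ltW ?.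
Qed.

(** A point outside the larger box is at distance more than 2 M T + 1 from the
support of g, so the speed of propagation keeps u zero there up to time T. *)
Lemma jet_support (c g : R3 -> R) u ut utt ux utx uxx (M T L : R) :
  wave_jet c g u ut utt ux utx uxx -> continuous c ->
  (forall x, 0 < c x <= M) -> 0 < T -> (forall x, ~ box L x -> g x = 0) ->
  forall x t, 0 <= t <= T -> ~ box (L + (2 * M * T + 1)) x -> u (x, t) = 0.
Proof.
move=> J cc c0M T0 gL x t tT nB.
set s := 2 * M * T + 1.
have M0 : 0 < M by case/andP: (c0M x) => ? /(lt_le_trans _); apply.
have s0 : 0 < s by rewrite /s addr_gt0// !mulr_gt0.
apply: (finite_propagation J cc c0M T0 s0) tT; first by rewrite /s ltrDl.
move=> y rho_y.
have [i xi] : exists i, L + s < `|coord i x|.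
  apply: contrapT => /forallNP H; apply: nB; apply/boxE.
  by split; rewrite leNgt; apply/negP; [exact: (H X1)|exact: (H X2)|exact: (H X3)].
have yi : `|coord i y - coord i x| < s.
  rewrite -(@ltr_pXn2r _ 2) ?nnegrE ?normr_ge0 ?(ltW s0)//.
  rewrite real_normK ?num_real// (le_lt_trans _ rho_y)//.
  have := sqr_ge0 (coord X1 y - coord X1 x); have := sqr_ge0 (coord X2 y - coord X2 x).
  by have := sqr_ge0 (coord X3 y - coord X3 x); case: (i); lra.
have Ly : L < `|coord i y|.
  have := ler_normB (coord i y) (coord i y - coord i x).
  by rewrite opprB addrC subrK; move: xi yi; lra.
have cn : continuous (fun z : R3 => `|coord i z|).
  apply: (@cont_comp _ _ _ (coord i) Num.norm); first exact: norm_continuous.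
  exact: coord_continuous.
have : \forall z \near y, L < `|coord i z| by apply: (cvgr_gt _ (cn y)).
apply: filterS => z Lz; apply: gL => /boxE[b1 b2 b3]; move: Lz; rewrite ltNge.
by case: (i); rewrite /= ?b1 ?b2 ?b3.
Qed.

(** The duality relation for r(x, t) = q(x, T - t), with a box large enough to
contain the supports of g, of q(., 0) and the ball of radius a. *)
Lemma final_initial_pairing (a T c0 : R) (c g : R3 -> R) (q : R3 * R -> R) :
  0 < a -> 0 < T -> smooth c -> (forall x, 0 < c x) ->
  (forall x, ~ ball3 a x -> c x = c0) -> Cc_infty setT g ->
  final_solution c T g q ->
  exists2 K, a < K & [/\ continuous g, continuous (fun x : R3 => q (x, 0)),
    (forall x, ~ box K x -> g x = 0), (forall x, ~ box K x -> q (x, 0) = 0) &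
    forall f p, initial_solution c f p -> continuous (fun x : R3 => p (x, T)) /\
      boxint K (fun x => p (x, T) * g x / c x ^+ 2) =
      boxint K (fun x => f x * q (x, 0) / c x ^+ 2)].
Proof.
move=> a0 T0 sc c_gt0 c_out Cg solq.
have cc := smooth_continuous sc.
have [M0 hM0] : exists M, forall x, `|c x| <= M.
  apply: (bounded_cst_out (K := a) (k := c0) cc) => x nB.
  by apply: c_out => /ball3_box.
have c0M x : 0 < c x <= M0.
  by rewrite c_gt0 (le_trans (ler_norm _))//.
have c_neq0 x : c x != 0 by rewrite gt_eqF.
have [L0 L00 gL0] := Cc_support Cg.
have [v [vt [vtt [vx [vtx [vxx [Jv vq]]]]]]] := final_jet solq.
have M00 : 0 < M0 by case/andP: (c0M (0, 0, 0)) => ? /(lt_le_trans _); apply.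
pose L := L0 + (2 * M0 * T + 1).
have L_gt : L0 < L by rewrite /L ltrDl addr_gt0// !mulr_gt0.
have L0' : 0 < L by exact: lt_trans L_gt.
have v_out := jet_support Jv cc c0M T0 gL0.
have vqT : (fun x => q (x, 0)) = (fun x => v (x, T)).
  by apply/funext => x; rewrite vq// subrr.
have gv : g = (fun x => v (x, 0)) by apply/funext => x; rewrite (jet_u0 Jv).
pose K := L + a.
have LK : L < K by rewrite /K ltrDl.
have box_mono (r r' : R) x : r <= r' -> box r x -> box r' x.
  by move=> rr' /boxE[b1 b2 b3]; apply/boxE; split; exact: le_trans rr'.
exists K; [by rewrite /K ltrDr|split].
- by rewrite gv; apply: continuous_slice; exact: jet_u Jv.
- by rewrite vqT; apply: continuous_slice; exact: jet_u Jv.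
- by move=> x nB; apply: gL0; apply: contra_not nB; apply: box_mono; lra.
- move=> x nB; have /= -> := congr1 (@^~ x) vqT; apply: v_out; first by rewrite ltW/=.
  by apply: contra_not nB; apply: box_mono; rewrite -/L ltW.
- move=> f p solp.
  have [u [ut [utt [ux [utx [uxx [Ju up]]]]]]] := initial_jet solp.
  have upT : (fun x => p (x, T)) = (fun x => u (x, T)).
    by apply/funext => x; rewrite up.
  split; first by rewrite upT; apply: continuous_slice; exact: jet_u Ju.
  rewrite (@eq_boxint _ K _ (fun x => u (x, T) * g x / c x ^+ 2)); last first.
    by move=> x _; rewrite -[p (x, T)]/((fun x => p (x, T)) x) upT.
  rewrite (wave_pairing Ju Jv cc c_neq0 T0 L0' LK v_out).
  by apply: eq_boxint => x _; rewrite vq// subrr.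
Qed.
End Final.

Unset Implicit Arguments.

Theorem theorem3p3 (R : realType) (a T c0 : R) (c : R3 R -> R)
    (A : L2 (leb_ball a) -> L2 (@leb3 R))
    (Astar : L2 (@leb3 R) -> L2 (leb_ball a))
    (g : R3 R -> R) (q : R3 R * R -> R)
    (ha : 0 < a) (hT : 0 < T)
    (c_smooth : smooth c) (c_gt0 : forall x, 0 < c x)
    (c0_gt0 : 0 < c0) (c_out : forall x, ~ ball3 a x -> c x = c0)
    (A_bounded : bounded_linear A)
    (A_wave : maps_initial_pressure T c A)
    (A_adjoint : is_adjoint c A Astar)
    (hg : Cc_infty setT g) (hq : final_solution c T g q) :
  forall G : L2 (@leb3 R), G = g %[ae @leb3 R] ->
    Astar G = (fun x => \1_(ball3 a) x * q (x, 0)) %[ae leb_ball a].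
Proof.
move=> G Gg.
have [K aK [cg cq g_out q_out pairing]] :=
  final_initial_pairing ha hT c_smooth c_gt0 c_out hg hq.
have cc := smooth_continuous c_smooth.
pose ic (x : R3 R) : R := (c x ^+ 2)^-1.
have cic : continuous ic.
  by apply: cont_inv => [x|]; [rewrite expf_neq0// gt_eqF|cont].
have [Mc hMc] : exists M, forall x, `|ic x| <= M.
  apply: (bounded_cst_out (K := a) (k := (c0 ^+ 2)^-1) cic) => x nB.
  by rewrite /ic c_out// => /ball3_box.
have [Mq hMq] : exists M, forall x, `|q (x, 0)| <= M.
  exact: (bounded_cst_out (K := K) (k := 0) cq).
have bnd (h : M3 R -> R) (M : R) : (forall x, `|h x| <= M) -> [bounded h x | x in setT].
  move=> hM; exists M; split; first exact: num_real.
  by move=> N MN x _ /=; rewrite (le_trans (hM x))// ltW.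
have fin : (leb_ball a setT < +oo)%E by exact: leb_ball_fin.
have mic : measurable_fun setT (ic : M3 R -> R) by exact: continuous_measurable3.
have mq : measurable_fun setT ((fun x => q (x, 0)) : M3 R -> R).
  exact: continuous_measurable3.
have iq : (leb_ball a).-integrable setT (EFin \o (fun x : M3 R => q (x, 0))).
  by apply: measurable_bounded_integrable => //; exact: bnd hMq.
have iAs : (leb_ball a).-integrable setT (EFin \o Astar G).
  apply/Lfun1_integrable; apply: Lfun_subset12; last exact: LfunP.
  by rewrite ge0_fin_numE.
(* The factor c^-2 of the pairing goes with the function to be shown null. *)
pose w (x : M3 R) : R := (Astar G x - q (x, 0)) * ic x.
have times_ic (h : M3 R -> R) : (leb_ball a).-integrable setT (EFin \o h) ->
    (leb_ball a).-integrable setT (EFin \o (fun x => h x * ic x)).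
  by move=> ih; apply: (integrableMl measurableT ih mic); exact: bnd hMc.
have iw : (leb_ball a).-integrable setT (EFin \o w).
  by apply: times_ic; apply: eq_integrable (integrableB measurableT iAs iq).
have w0 b al n : 0 < b -> b < a ->
    (\int[leb_ball a]_x (bump b al n x * w x)%:E = 0)%E.
  move=> b0 ba.
  have Cf := bump_Cc al b0 ba n; set f := bump b al n in Cf *.
  have mf : measurable_fun setT (f : M3 R -> R).
    by apply: continuous_measurable3; exact: bump_continuous.
  have bf : [bounded f x | x in setT] by apply: (bnd _ 1); exact: bump_norm_le1.
  have f_out x : ~ ball3 a x -> f x = 0.
    move=> nB; apply: contrapT => /eqP fx; apply: nB.
    by case: Cf => _ _; apply; exact: subset_closure.
  have [p solp AF] := A_wave f Cf.
  have [cp pair] := pairing f p solp.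
  pose F : L2 (leb_ball a) := Lfun_Sub (lee1n 2) (bump_Lfun a b al n).
  have FE : (F : M3 R -> R) = f by exact: Lfun_valP.
  have {}AF : A F = (fun x => p (x, T)) %[ae leb3].
    by apply: AF; rewrite FE; exact: aeW.
  have times_f (h : M3 R -> R) : (leb_ball a).-integrable setT (EFin \o h) ->
      (leb_ball a).-integrable setT (EFin \o (fun x => f x * h x)).
    by move=> ih; apply: (integrableMr measurableT mf bf ih).
  (* The representatives A F and G may be replaced by p (., T) and g. *)
  have E1 : \int[leb3]_x (A F x * G x / c x ^+ 2) =
      boxint K (fun x => p (x, T) * g x / c x ^+ 2).
    rewrite -integral_boxint; last by move=> x /g_out ->; rewrite mulr0 mul0r.
    apply: (congr1 fine); apply: ae_eq_integral => //.
    - apply/measurable_EFinP; apply: measurable_funM => //.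
      exact: measurable_funM.
    - apply/measurable_EFinP; apply: measurable_funM => //.
      by apply: measurable_funM; exact: continuous_measurable3.
    - near=> x => _; congr (_%:E); congr (_ * _ / _); near: x.
      + by apply: filterS AF => x; apply.
      + by apply: filterS Gg => x; apply.
  have E2 : \int[leb_ball a]_x (f x * q (x, 0) / c x ^+ 2) =
      boxint K (fun x => f x * q (x, 0) / c x ^+ 2).
    by apply: integral_leb_ball; [exact: ltW|move=> x /f_out ->; rewrite !mul0r].
  have E3 := A_adjoint F G.
  rewrite E1 pair -E2 FE in E3.
  have i1 := times_f _ (times_ic _ iAs).
  have i2 := times_f _ (times_ic _ iq).
  have E4 : \int[leb_ball a]_x (f x * w x) = 0.
    transitivity (\int[leb_ball a]_x (f x * (Astar G x * ic x)) -
        \int[leb_ball a]_x (f x * (q (x, 0) * ic x))).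
      rewrite -(RintegralB measurableT i1 i2); apply: eq_Rintegral => x _.
      by rewrite /w mulrBl mulrBr.
    have e1 : \int[leb_ball a]_x (f x * (Astar G x * ic x)) =
        \int[leb_ball a]_x (f x * Astar G x / c x ^+ 2).
      by apply: eq_Rintegral => x _; rewrite mulrA.
    have e2 : \int[leb_ball a]_x (f x * (q (x, 0) * ic x)) =
        \int[leb_ball a]_x (f x * q (x, 0) / c x ^+ 2).
      by apply: eq_Rintegral => x _; rewrite mulrA.
    by rewrite e1 e2 E3 subrr.
  have i3 := times_f _ iw.
  rewrite -[LHS]fineK; last exact: integrable_fin_num.
  by rewrite -/(Rintegral _ _ _) E4.
have aew := null_of_tests ha iw w0; have aeB := ae_ball3 a.
near=> x => _.
have Bx : ball3 a x by near: x.
have : w x = 0 by move: Bx; near: x.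
rewrite /w /ic => /eqP; rewrite mulf_eq0 invr_eq0 expf_eq0 /= (gt_eqF (c_gt0 x)) orbF subr_eq0.
by move/eqP => ->; rewrite indicE mem_set// mul1r.
Unshelve. all: by end_near. Qed.
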